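(* Let $T$ be a locally finite, infinite tree with root $o$ in which every vertex has forward degree at least $2$, and consider a transient nearest neighbour random walk on $T$ such that $F(x,x^-)<1$ for every $x\in T\setminus\{o\}$ and $\lim_{x\to\infty} G(x,o) = 0$ (i.e. for every $\varepsilon>0$ there is a finite set outside of which $G(\cdot,o)<\varepsilon$). Then $\phi = G(\cdot,o)$ is an ultrametric element on $T$, and the K-process on $\partial T$ induced by the Dirichlet form $\mathcal{E}_{HD}$ coincides with the standard process associated with the ultrametric element $\phi = G(\cdot,o)$ and the limit distribution $\nu_o$ of the random walk; that is, for all $\varphi,\psi\in\mathcal{D}(\partial T,P)$, $$\mathcal{E}_{HD}(\varphi,\psi) = \frac12\int_{\partial T}\int_{\partial T}(\varphi(\xi)-\varphi(\eta))(\psi(\xi)-\psi(\eta))\,J_{\phi,\nu_o}(\xi,\eta)\,d\nu_o(\xi)\,d\nu_o(\eta).$$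
   Context: Tree notation: for $x\neq o$, $x^-$ is the neighbour of $x$ on the geodesic from $o$ to $x$; forward degree of $x$ is $|\{y:y^-=x\}|$; $E(T)=\{[x^-,x]:x\neq o\}$. $\partial T$ is the space of ends (classes of geodesic rays modulo finite symmetric difference); $\pi(o,\xi)$ is the ray from $o$ to $\xi$; $T_x = \{y : x\in\text{geodesic from } o \text{ to } y\}$, $\partial T_x$ the ends represented by rays in $T_x$; for $\xi\neq\eta$, $\xi\wedge\eta$ is the last common vertex of $\pi(o,\xi),\pi(o,\eta)$. An ultrametric element is $\phi:T\to(0,\infty)$ with $\phi(x^-)>\phi(x)$ ($x\ne o$) and $\phi\to0$ along every geodesic ray; it gives the ultrametric $d_\phi(\xi,\eta)=\phi(\xi\wedge\eta)$ ($\xi\ne\eta$) with closed balls $B_\phi(\xi,r)$. Random walk: stochastic matrix $p(x,y)>0$ iff $x\sim y$; $G(x,y)=\sum_n p^{(n)}(x,y)<\infty$ (transience); $F(x,y)$ the probability of ever reaching $y$ from $x$; $\nu_x$ the distribution of the almost sure limit end $Z_\infty$ of the walk started at $x$; Poisson transform $h_\varphi(x)=\int\varphi\,d\nu_x$. Let $\mathsf{m}(o)=1$, $\mathsf{m}(x)=\prod_{i=1}^k p(x_{i-1},x_i)/p(x_i,x_{i-1})$ for $\pi(o,x)=[x_0=o,\dots,x_k=x]$, $a(x^-,x)=\mathsf{m}(x)p(x,x^-)$, $\mathcal{E}_T(f,g)=\sum_{[x^-,x]\in E(T)}(f(x)-f(x^-))(g(x)-g(x^-))a(x^-,x)$, $\mathcal{D}(\partial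 T,P)=\{\varphi\in L^1(\partial T,\nu_o):\mathcal{E}_T(h_\varphi,h_\varphi)<\infty\}$, $\mathcal{E}_{HD}(\varphi,\psi)=\mathcal{E}_T(h_\varphi,h_\psi)$. The K-process is the Markov process on $\partial T$ associated with the Dirichlet form $\mathcal{E}_{HD}$ (reference measure $\nu_o$). For an ultrametric element $\phi$ and a fully supported Borel probability measure $\mu$ on $\partial T$, the standard $(\phi,\mu)$-process is the Hunt process with Markov semigroup $P^tf(\xi)=\int P_rf(\xi)\,d\sigma_*^t(r)$, where $P_rf(\xi)=\mu(B_\phi(\xi,r))^{-1}\int_{B_\phi(\xi,r)}f\,d\mu$ and $\sigma_*^t([0,r))=e^{-t/r}$; its Dirichlet form is $\frac12\iint(u(\xi)-u(\eta))(v(\xi)-v(\eta))J_{\phi,\mu}(\xi,\eta)\,d\mu\,d\mu$ with $J_{\phi,\mu}(\xi,\eta)=\frac1{\phi(o)}+\int_{1/\phi(o)}^{1/\phi(\xi\wedge\eta)}\frac{dt}{\mu(B_\phi(\xi,1/t))}$ for $\xi\neq\eta$. Processes are identified via their Dirichlet forms. *)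

(* Defs.v *)
From HB Require Import structures.
From mathcomp Require Import all_boot all_order all_algebra.
From mathcomp Require Import all_classical all_reals all_analysis.
Set Implicit Arguments. Unset Strict Implicit. Unset Printing Implicit Defensive.
Import Order.TTheory GRing.Theory Num.Theory.
Import numFieldNormedType.Exports.
Local Open Scope classical_set_scope.
Local Open Scope ring_scope.

(* A rooted tree with vertex type V, root o, predecessor map par (x^- = par x
   for x <> o), finite list of forward neighbours ch x (local finiteness),
   and depth (graph distance to o) dep. *)
Section Tree.
Context {V : pointedType} (o : V) (par : V -> V) (ch : V -> seq V) (dep : V -> nat).

Definition is_rooted_tree : Prop :=
  [/\ dep o = 0%N,
      (forall x, x != o -> dep x = (dep (par x)).+1),
      (forall x, uniq (ch x)) &
      (forall x y, (y \in ch x) = (y != o) && (par y == x))].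

Definition adj (x y : V) : bool := (y \in ch x) || (x \in ch y).

Definition nbrs (x : V) : seq V := if x == o then ch x else par x :: ch x.

Definition in_subtree (y x : V) : bool :=
  [exists k : 'I_(dep x).+1, iter k par x == y].

Definition level (n : nat) : seq V := iter n (fun s => flatten (map ch s)) [:: o].

Definition geodesic_ray (r : nat -> V) : Prop :=
  forall n, adj (r n) (r n.+1) /\ r n.+2 != r n.

(* geodesic rays starting at o: these represent the ends of T
   (pi(o,xi) is a bijection between ends and such rays) *)
Definition ray_from_o (r : nat -> V) : Prop :=
  r 0%N = o /\ forall n, r n.+1 \in ch (r n).
End Tree.

(* Ends are represented by the rays from o, a subset of V^nat.  The sigma
   algebra is the one generated by the coordinate cylinders; its trace on the
   set of rays is the Borel sigma-algebra of the end space. *)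
Definition coord_cyl (V : pointedType) : set (set (nat -> V)) :=
  [set A | exists n v, A = [set r : nat -> V | r n = v]].

Definition Ends (V : pointedType) := g_sigma_algebraType (@coord_cyl V).

Section EndSpace.
Context {V : pointedType} (o : V) (par : V -> V) (ch : V -> seq V) (dep : V -> nat).

Definition bdry : set (Ends V) := [set r | ray_from_o o ch r].

Definition bdry_sub (y : V) : set (Ends V) := [set r | bdry r /\ r (dep y) = y].

Definition first_diff (r s : nat -> V) : nat :=
  match pselect (exists n, r n != s n) with
  | left H => ex_minn H
  | right _ => 0%N
  end.

Definition confl (r s : nat -> V) : V := r (first_diff r s).-1.

Context {R : realType}.

Definition is_ultrametric_element (phi : V -> R) : Prop :=
  [/\ (forall x, 0 < phi x),
      (forall x, x != o -> phi x < phi (par x)) &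
      (forall r : nat -> V, geodesic_ray ch r -> (phi \o r) @ \oo --> 0)].

Definition udist (phi : V -> R) (r s : nat -> V) : R :=
  if pselect (r = s) then 0 else phi (confl r s).

Definition uball (phi : V -> R) (r : Ends V) (rad : R) : set (Ends V) :=
  [set s | bdry s /\ udist phi r s <= rad].

(* jump kernel J_{phi,mu}; on the diagonal (where it is not defined and the
   integrand of the Dirichlet form vanishes) we put 0 *)
Definition Jkernel (phi : V -> R) (mu : {measure set (Ends V) -> \bar R})
    (r s : Ends V) : \bar R :=
  let a : R := (phi o)^-1 in
  let b : R := (phi (confl r s))^-1 in
  let integrand : R -> R := fun t => (fine (mu (uball phi r t^-1)))^-1 in
  if pselect (r = s) then 0%E else
  (a%:E + \int[lebesgue_measure]_(t in `[a, b]) (integrand t)%:E)%E.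
End EndSpace.

Section RW.
Context {V : pointedType} (o : V) (par : V -> V) (ch : V -> seq V) (dep : V -> nat).
Context {R : realType} (p : V -> V -> R).

Definition is_nn_random_walk : Prop :=
  [/\ (forall x y, 0 <= p x y),
      (forall x y, 0 < p x y <-> adj ch x y) &
      (forall x, \sum_(y <- nbrs o par ch x) p x y = 1)].

Fixpoint pn (n : nat) (x y : V) : R :=
  match n with
  | 0%N => (x == y)%:R
  | m.+1 => \sum_(z <- nbrs o par ch x) p x z * pn m z y
  end.

Fixpoint fpn (n : nat) (x y : V) : R :=
  match n with
  | 0%N => (x == y)%:R
  | m.+1 => if x == y then 0 else \sum_(z <- nbrs o par ch x) p x z * fpn m z y
  end.

Definition green_series (x y : V) : \bar R := (\sum_(0 <= n <oo) (pn n x y)%:E)%E.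

Definition green (x y : V) : R := fine (green_series x y).

Definition transient : Prop := forall x y, (green_series x y < +oo)%E.

Definition hitF (x y : V) : R := fine (\sum_(0 <= n <oo) (fpn n x y)%:E)%E.

Fixpoint probT (n : nat) (x y : V) : R :=
  match n with
  | 0%N => (in_subtree par dep y x)%:R
  | m.+1 => \sum_(z <- nbrs o par ch x) p x z * probT m z y
  end.

(* nu_x is the distribution of the limit end Z_oo of the walk started at x.
   Since Z_n -> Z_oo a.s. and dT_y is clopen, nu_x(dT_y) = lim_n P_x[Z_n in T_y];
   by this condition on the generating cylinders nu_x is uniquely determined. *)
Definition is_limit_distribution (nu : V -> probability (Ends V) R) : Prop :=
  forall x, nu x (bdry o ch) = 1%E /\
    forall y, (fun n => (probT n x y)%:E) @ \oo --> nu x (bdry_sub o ch dep y).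

Definition mass (x : V) : R :=
  \prod_(i < dep x) (let y := iter i par x in p (par y) y / p y (par y)).

Definition cond (x : V) : R := mass x * p x (par x).

Definition ET_partial (f g : V -> R) (N : nat) : R :=
  \sum_(1 <= n < N) \sum_(x <- level o ch n)
     (f x - f (par x)) * (g x - g (par x)) * cond x.

Definition ET (f g : V -> R) : R := limn (ET_partial f g).

Definition poisson (nu : V -> probability (Ends V) R) (phi : Ends V -> R) (x : V) : R :=
  fine (\int[nu x]_(r in bdry o ch) (phi r)%:E)%E.

Definition in_D (nu : V -> probability (Ends V) R) (phi : Ends V -> R) : Prop :=
  (nu o).-integrable (bdry o ch) (EFin \o phi) /\
  cvgn (ET_partial (poisson nu phi) (poisson nu phi)).

Definition E_HD (nu : V -> probability (Ends V) R) (phi psi : Ends V -> R) : R :=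
  ET (poisson nu phi) (poisson nu psi).
End RW.

(* Main.v *)
(* Write G = G(., o), lam = 1/G, A_x = nu_o(dT_x), and X_x for the nu_o-average of
   f over dT_x.  First passage from x to x^- gives
   nu_x = F(x,x^-) nu_{x^-} + (1 - F(x,x^-)) nu_o(. | dT_x), so the Poisson transform
   satisfies h_x = F h_{x^-} + (1 - F) X_x with F = G_x / G_{x^-}; reversibility and the
   net flow through an edge give a(x^-,x) (G_{x^-} - G_x) = A_x.  With
   M_x = lam_x (X_x - h_x), the process M along a nu_o-random ray is a martingale, the
   energy of h up to level N is the sum of A_x (G_{x^-} - G_x) M_x^2, and it differs from
   the sum V_N of lam_{x^-} A_x (X_x - X_{x^-})^2 by the boundary term
   B_N = sum of A_x G_x M_x^2 over level N.  Thomson's principle, applied with the finitely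
   supported potentials (G - eps)^+ (this is where G -> 0 is used), bounds B_N by the
   remaining energy of h, so V_N tends to the energy of h.
   Along a geodesic, the jump kernel is the sum of the jumps of lam divided by A, whence
   the double integral is a sum over vertices x of (jump of lam at x) times the
   nu_o-variance of f on dT_x; L^1-density of locally constant functions identifies it
   with lim V_N, and in particular f is in L^2.  Polarization and Fubini conclude. *)
Require Import Defs.
From HB Require Import structures.
From mathcomp Require Import all_boot all_order all_algebra.
From mathcomp Require Import all_classical all_reals all_analysis.
From mathcomp Require Import measurable_realfun.
From mathcomp Require Import ring lra zify.
Import Order.TTheory GRing.Theory Num.Theory.
Import numFieldNormedType.Exports HBSimple.
Local Open Scope classical_set_scope.
Local Open Scope ring_scope.
Set Implicit Arguments. Unset Strict Implicit. Unset Printing Implicit Defensive.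

(** * Rooted trees *)

(** [M] is a current: since [cond x * (G (par x) - G x) = A x], the flow of [h] through the edge
    above [x] equals [A x * M x], and the martingale property of [M] is Kirchhoff's node law. The
    obstacle is that a function in [in_D] is a priori only in L^1, so L^2 convergence of its
    averages cannot be presupposed. The boundary term is therefore controlled by the energy itself:
    a finitely supported potential whose increments are at most those of [G] makes the summation by
    parts stop at a finite depth. Then [lim V_N] is finite. Because [1 / G] is a sum of rates along
    a geodesic that begins with the rate at the root, this limit dominates the second moments of all
    averages; truncating [f] at height [K], which makes its square Lipschitz, converts
    L^1-approximation into an L^2 bound. The measures [nu x] are given only through limits of
    [probT] on cells. Hence the mixture formula for [nu x] is derived cell by cell from Green
    functions and then extended by uniqueness of measures. *)

Definition anc (V : Type) (par : V -> V) (dep : V -> nat) k x := iter (dep x - k) par x.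

Section Tree.
Context {V : pointedType} {o : V} {par : V -> V} {ch : V -> seq V} {dep : V -> nat}.
Hypothesis Ht : is_rooted_tree o par ch dep.

Lemma chE x y : (y \in ch x) = (y != o) && (par y == x).
Proof. by case: Ht. Qed.

Lemma ch_uniq x : uniq (ch x). Proof. by case: Ht. Qed.

Lemma dep_root : dep o = 0%N. Proof. by case: Ht. Qed.

Lemma dep_par x : x != o -> dep x = (dep (par x)).+1.
Proof. by case: Ht => _ /(_ x). Qed.

Lemma dep_eq0 x : (dep x == 0%N) = (x == o).
Proof.
by have [->|xo] := eqVneq x o; [rewrite dep_root eqxx | rewrite (dep_par xo)].
Qed.

Lemma dep_ch x y : y \in ch x -> dep y = (dep x).+1.
Proof. by rewrite chE => /andP[yo /eqP <-]; exact: dep_par. Qed.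

Lemma par_ch x y : y \in ch x -> par y = x.
Proof. by rewrite chE => /andP[_ /eqP]. Qed.

Lemma ch_neq_root x y : y \in ch x -> y != o.
Proof. by rewrite chE => /andP[]. Qed.

Lemma mem_ch_par x : x != o -> x \in ch (par x).
Proof. by rewrite chE eqxx andbT. Qed.

Lemma mem_level n x : (x \in level o ch n) = (dep x == n).
Proof.
elim: n x => [|n IH] x; first by rewrite inE dep_eq0.
rewrite /level iterS -/(level o ch n); apply/flatten_mapP/idP.
  by move=> [y]; rewrite IH => /eqP <- /dep_ch ->.
have [->|xo] := eqVneq x o; first by rewrite dep_root.
rewrite (dep_par xo) eqSS => dx; exists (par x); first by rewrite IH.
exact: mem_ch_par.
Qed.

Lemma level_uniq n : uniq (level o ch n).
Proof.
elim: n => [//|n IH]; rewrite /level iterS -/(level o ch n).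
elim: (level o ch n) IH => //= x s IHs /andP[xs us].
rewrite cat_uniq ch_uniq IHs // andbT; apply/hasPn => y /flatten_mapP[z zs yz].
by apply/negP => yx; move: xs; rewrite -(par_ch yx) (par_ch yz) zs.
Qed.

Lemma big_levelS (R : nmodType) n (F : V -> R) :
  \sum_(y <- level o ch n.+1) F y = \sum_(x <- level o ch n) \sum_(y <- ch x) F y.
Proof. by rewrite /level iterS big_flatten big_map. Qed.

Lemma dep_iter_par k x : (k <= dep x)%N -> dep (iter k par x) = (dep x - k)%N.
Proof.
elim: k => [|k IH] kx; first by rewrite subn0.
have ek := IH (ltnW kx).
have ko : iter k par x != o by rewrite -dep_eq0 ek; lia.
by move: (dep_par ko); rewrite ek iterS; lia.
Qed.

Local Notation anc := (anc par dep).

Lemma dep_anc k x : (k <= dep x)%N -> dep (anc k x) = k.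
Proof. by move=> kx; rewrite /anc dep_iter_par; lia. Qed.

Lemma anc_dep x : anc (dep x) x = x.
Proof. by rewrite /anc subnn. Qed.

Lemma anc0 x : anc 0 x = o.
Proof. by apply/eqP; rewrite -dep_eq0 dep_anc. Qed.

Lemma anc_par k x : x != o -> (k < dep x)%N -> anc k x = anc k (par x).
Proof. by move=> xo; rewrite /anc (dep_par xo) => kx; rewrite subSn // iterSr. Qed.

Lemma in_subtreeE y x : in_subtree par dep y x = (dep y <= dep x)%N && (anc (dep y) x == y).
Proof.
apply/existsP/andP => [[k /eqP <-]|[yx /eqP e]].
  have kx : (k <= dep x)%N by have := ltn_ord k; lia.
  by rewrite dep_iter_par // leq_subr /anc subKn.
have lt : (dep x - dep y < (dep x).+1)%N by lia.
by exists (Ordinal lt); apply/eqP.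
Qed.

Lemma in_subtree_root x : in_subtree par dep o x.
Proof. by rewrite in_subtreeE dep_root anc0 eqxx. Qed.

Lemma in_subtree_refl x : in_subtree par dep x x.
Proof. by rewrite in_subtreeE leqnn anc_dep eqxx. Qed.

Lemma in_subtree_rootr y : in_subtree par dep y o = (y == o).
Proof.
rewrite in_subtreeE dep_root leqn0 dep_eq0.
by have [->|//] := eqVneq y o; rewrite dep_root anc0 eqxx.
Qed.

Lemma in_subtree_par y x : x != o ->
  in_subtree par dep y x = (x == y) || in_subtree par dep y (par x).
Proof.
move=> xo; have [<-|xy] /= := eqVneq x y; first exact: in_subtree_refl.
have dx := dep_par xo; rewrite !in_subtreeE; case: (ltngtP (dep y) (dep x)) => d.
- by rewrite -anc_par //; have -> : (dep y <= dep (par x))%N by lia.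
- by have -> : (dep y <= dep (par x))%N = false by lia.
- have -> : (dep y <= dep (par x))%N = false by lia.
  by rewrite d anc_dep (negbTE xy).
Qed.

Lemma in_subtree_ch y x z : z \in ch x ->
  in_subtree par dep y z = (z == y) || in_subtree par dep y x.
Proof. by move=> zx; rewrite in_subtree_par ?(ch_neq_root zx) // (par_ch zx). Qed.

Lemma in_subtree_dep y x : in_subtree par dep y x -> (dep y <= dep x)%N.
Proof. by rewrite in_subtreeE => /andP[]. Qed.

Lemma in_subtree_same_dep y x : in_subtree par dep y x -> dep x = dep y -> x = y.
Proof. by rewrite in_subtreeE => /andP[_ /eqP e] d; rewrite -[LHS]anc_dep d. Qed.

Lemma anc_anc j k x : (j <= k <= dep x)%N -> anc j (anc k x) = anc j x.
Proof.
move=> /andP[jk kx]; rewrite {1}/anc dep_anc // /anc -iterD.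
by congr (iter _ _ _); lia.
Qed.

Lemma in_subtree_trans x y z :
  in_subtree par dep x y -> in_subtree par dep y z -> in_subtree par dep x z.
Proof.
rewrite !in_subtreeE => /andP[xy /eqP exy] /andP[yz /eqP eyz].
by rewrite (leq_trans xy yz) -(anc_anc (k := dep y)) ?xy // eyz exy eqxx.
Qed.

Lemma in_subtree_anti x y : in_subtree par dep x y -> in_subtree par dep y x -> x = y.
Proof.
move=> xy yx; apply: (in_subtree_same_dep yx).
by have := in_subtree_dep xy; have := in_subtree_dep yx; lia.
Qed.

Lemma par_notin_subtree x : x != o -> in_subtree par dep x (par x) = false.
Proof. by move=> xo; apply/negbTE/negP => /in_subtree_dep; rewrite (dep_par xo) ltnn. Qed.

Lemma nbrs_uniq x : uniq (nbrs o par ch x).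
Proof.
rewrite /nbrs; have [_|xo] := eqVneq x o; first exact: ch_uniq.
rewrite /= ch_uniq andbT; apply/negP => /dep_ch; rewrite (dep_par xo); lia.
Qed.

Lemma nbrsE x y : (y \in nbrs o par ch x) = adj ch x y.
Proof.
rewrite /nbrs /adj (chE y x); have [->|xo] := eqVneq x o; first by rewrite orbF.
by rewrite inE orbC eq_sym.
Qed.

Lemma adj_sym x y : adj ch x y = adj ch y x.
Proof. by rewrite /adj orbC. Qed.

(** [T_x] is joined to its complement by the single edge between [x] and [par x]. This lemma handles
    steps that start inside, the next one steps that start outside; flow and first-passage
    identities rest on both. *)
Lemma in_subtree_nbr x z w : in_subtree par dep x z -> w \in nbrs o par ch z ->
  in_subtree par dep x w || ((w == par x) && (z == x)).
Proof.
move=> xz; rewrite nbrsE => /orP[wz|zw]; first by rewrite (in_subtree_ch _ wz) xz orbT.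
move: xz; rewrite (in_subtree_ch _ zw) => /orP[/eqP zx|->//].
by rewrite -zx (par_ch zw) !eqxx orbT.
Qed.

Lemma nbr_in_subtree x z w : ~~ in_subtree par dep x z -> w \in nbrs o par ch z ->
  in_subtree par dep x w = (w == x) && (z == par x).
Proof.
move=> xz; rewrite nbrsE => /orP[wz|zw].
  rewrite (in_subtree_ch _ wz) (negbTE xz) orbF.
  by have [<-|//] := eqVneq w x; rewrite (par_ch wz) eqxx.
move: xz; rewrite (in_subtree_ch _ zw) => /norP[zx /negbTE xw].
rewrite xw; apply/esym/negbTE/negP => /andP[/eqP wx _].
by move: xw; rewrite wx in_subtree_refl.
Qed.

Lemma ray_dep r : ray_from_o o ch r -> forall n, dep (r n) = n.
Proof.
case=> r0 rS; elim=> [|n IH]; first by rewrite r0 dep_root.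
by rewrite (dep_ch (rS n)) IH.
Qed.

Lemma ray_par r n : ray_from_o o ch r -> par (r n.+1) = r n.
Proof. by case=> _ /(_ n)/par_ch. Qed.

Lemma ray_level r n : ray_from_o o ch r -> r n \in level o ch n.
Proof. by move=> rr; rewrite mem_level (ray_dep rr). Qed.

Lemma ray_anc r k n : ray_from_o o ch r -> (k <= n)%N -> anc k (r n) = r k.
Proof.
move=> rr /subnK; move: (n - k)%N => j <-; rewrite /anc (ray_dep rr) addnK.
by elim: j => [//|j IH]; rewrite iterSr addSn ray_par.
Qed.

Lemma ray_subtree r y n : ray_from_o o ch r ->
  in_subtree par dep y (r n) = (dep y <= n)%N && (r (dep y) == y).
Proof.
move=> rr; rewrite in_subtreeE (ray_dep rr).
by have [yn|//] := leqP (dep y) n; rewrite ray_anc.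
Qed.

Lemma bdry_sub_subset x y : in_subtree par dep x y ->
  bdry_sub o ch dep y `<=` bdry_sub o ch dep x.
Proof.
move=> xy r [rr ry]; split=> //; apply/eqP.
by move: (ray_subtree x (dep y) rr); rewrite ry xy => /esym/andP[].
Qed.

Lemma bdry_sub_disjoint x y : ~~ in_subtree par dep x y -> ~~ in_subtree par dep y x ->
  bdry_sub o ch dep x `&` bdry_sub o ch dep y = set0.
Proof.
move=> xy yx; apply/seteqP; split=> // r [[rr rx] [_ ry]].
case/orP: (leq_total (dep x) (dep y)) => d.
  by move: xy; rewrite -ry ray_subtree // d rx eqxx.
by move: yx; rewrite -rx ray_subtree // d ry eqxx.
Qed.

Lemma big_level_ch (R : nmodType) x (F : V -> R) :
  \sum_(y <- level o ch (dep x).+1 | in_subtree par dep x y) F y = \sum_(y <- ch x) F y.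
Proof.
rewrite -[LHS]big_filter; apply: perm_big; apply: uniq_perm; rewrite ?ch_uniq //.
  exact/filter_uniq/level_uniq.
move=> y; rewrite mem_filter mem_level.
apply/andP/idP => [[xy /eqP dy]|yx]; last first.
  by rewrite (in_subtree_ch _ yx) in_subtree_refl orbT (dep_ch yx) eqxx.
have yo : y != o by rewrite -dep_eq0 dy.
move: xy; rewrite in_subtree_par // => /orP[/eqP e|xp]; first by move: dy; rewrite e; lia.
have e : dep (par y) = dep x by move: dy; rewrite (dep_par yo) => -[].
by rewrite chE yo (in_subtree_same_dep xp e) eqxx.
Qed.

End Tree.

(** * Green function, reversibility and flow *)

Lemma cvgn_uniq {R : realType} (u : nat -> R) (a b : R) :
  u @ \oo --> a -> u @ \oo --> b -> a = b.
Proof. exact: (cvg_unique (@Rhausdorff R)). Qed.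

Lemma ecvgn_uniq {R : realType} (u : nat -> \bar R) (a b : \bar R) :
  u @ \oo --> a -> u @ \oo --> b -> a = b.
Proof. exact: (cvg_unique (@ereal_hausdorff R)). Qed.

Section Walk.
Context {V : pointedType} {o : V} {par : V -> V} {ch : V -> seq V} {dep : V -> nat}.
Context {R : realType} {p : V -> V -> R}.
Hypothesis Ht : is_rooted_tree o par ch dep.
Hypothesis Hw : is_nn_random_walk o par ch p.

Local Notation pn := (pn o par ch p).
Local Notation fpn := (fpn o par ch p).
Local Notation probT := (probT o par ch dep p).
Local Notation green := (green o par ch p).
Local Notation nbrs := (nbrs o par ch).
Local Notation sub := (in_subtree par dep).
Local Notation hitF := (hitF o par ch p).

Lemma p_ge0 x y : 0 <= p x y. Proof. by case: Hw. Qed.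

Lemma p_gt0 x y : adj ch x y -> 0 < p x y.
Proof. by case: Hw => _ /(_ x y) [_]. Qed.

Lemma p_eq0 x y : ~~ adj ch x y -> p x y = 0.
Proof.
move=> nxy; apply/eqP; rewrite eq_le p_ge0 andbT leNgt; apply/negP.
by case: Hw => _ /(_ x y) [+ _] _ => /[apply]; exact/negP.
Qed.

Lemma sum_p x : \sum_(y <- nbrs x) p x y = 1. Proof. by case: Hw. Qed.

Lemma sum_p_delta x y : \sum_(z <- nbrs x) p x z * (z == y)%:R = p x y.
Proof.
have [yx|yx] := boolP (y \in nbrs x).
  rewrite (bigD1_seq y) ?(nbrs_uniq Ht) //= eqxx mulr1 big1 ?addr0 // => z /negbTE ->.
  by rewrite mulr0.
rewrite p_eq0 -?(nbrsE Ht) // big_seq big1 // => z zx.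
by case: eqP => [e|_]; [rewrite -e zx in yx | rewrite mulr0].
Qed.

Lemma pn_ge0 n x y : 0 <= pn n x y.
Proof.
elim: n x => [|n IH] x /=; first by rewrite ler0n.
by apply: sumr_ge0 => z _; rewrite mulr_ge0 ?p_ge0.
Qed.

Lemma fpn_ge0 n x y : 0 <= fpn n x y.
Proof.
elim: n x => [|n IH] x /=; first by rewrite ler0n.
by case: eqP => // _; apply: sumr_ge0 => z _; rewrite mulr_ge0 ?p_ge0.
Qed.

Lemma pnSr n x y : pn n.+1 x y = \sum_(z <- nbrs y) pn n x z * p z y.
Proof.
elim: n x => [|n IH] x.
  rewrite [LHS]/= sum_p_delta.
  have [yx|yx] := boolP (x \in nbrs y).
    rewrite (bigD1_seq x) ?(nbrs_uniq Ht) //= eqxx mul1r big1 ?addr0 // => z /negbTE.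
    by rewrite eq_sym => ->; rewrite mul0r.
  rewrite p_eq0 ?(adj_sym _ y) -?(nbrsE Ht) // big_seq big1 // => z zx /=.
  by case: eqP => [e|_]; [rewrite e zx in yx | rewrite mul0r].
rewrite -[LHS]/(\sum_(z <- nbrs x) p x z * pn n.+1 z y).
rewrite (eq_bigr (fun z => \sum_(w <- nbrs y) p x z * (pn n z w * p w y))).
  rewrite exchange_big; apply: eq_bigr => w _ /=.
  by rewrite mulr_suml; apply: eq_bigr => z _; rewrite mulrA.
by move=> z _; rewrite IH mulr_sumr.
Qed.

Local Notation mass := (mass par dep p).
Local Notation cond := (cond par dep p).

Lemma mass_root : mass o = 1.
Proof. by rewrite /mass (dep_root Ht) big_ord0. Qed.

Lemma mass_par x : x != o -> mass x = mass (par x) * (p (par x) x / p x (par x)).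
Proof.
move=> xo; rewrite /mass (dep_par Ht xo) big_ord_recl /= mulrC; congr (_ * _).
by apply: eq_bigr => i _; rewrite /bump /= -iterS -iterSr.
Qed.

Lemma adj_par x : x != o -> adj ch (par x) x.
Proof. by move=> xo; rewrite /adj (mem_ch_par Ht xo). Qed.

(** Every edge joins some [z] to [par z], and the product defining [mass] gains exactly the ratio of
    the two transition probabilities there: a nearest neighbour walk on a tree is reversible. *)
Lemma mass_balance x y : adj ch x y -> mass x * p x y = mass y * p y x.
Proof.
have key z : z != o -> mass (par z) * p (par z) z = mass z * p z (par z).
  move=> zo; rewrite (mass_par zo) -mulrA divfK // gt_eqF // p_gt0 //.
  by rewrite adj_sym adj_par.
by case/orP => e; move: (key _ (ch_neq_root Ht e)); rewrite (par_ch Ht e).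
Qed.

Lemma mass_gt0 x : 0 < mass x.
Proof.
apply: prodr_gt0 => i _ /=; set y := iter i par x.
have yo : y != o by rewrite -(dep_eq0 Ht) (dep_iter_par Ht); have := ltn_ord i; lia.
have ay := adj_par yo; apply: divr_gt0; apply: p_gt0 => //.
by rewrite adj_sym.
Qed.

Lemma cond_gt0 x : x != o -> 0 < cond x.
Proof. by move=> xo; rewrite mulr_gt0 ?mass_gt0 ?p_gt0 // adj_sym adj_par. Qed.

Lemma pn_reversible n x y : mass x * pn n x y = mass y * pn n y x.
Proof.
elim: n x y => [|n IH] x y.
  by rewrite /= (eq_sym y); have [->//|] := eqVneq x y; rewrite !mulr0.
rewrite [pn n.+1 y x]pnSr /= !mulr_sumr !big_seq.
apply: eq_bigr => z; rewrite (nbrsE Ht) => xz.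
by rewrite mulrA mass_balance // mulrAC IH mulrA.
Qed.

(** In one step the mass of [T_y] changes only through the edge above [y]: inflow minus outflow.
    Conditioning on the first step reduces everything to time 0, the only place where the geometry
    enters. *)
Lemma probT_flow n z y : y != o -> probT n.+1 z y - probT n z y =
  pn n z (par y) * p (par y) y - pn n z y * p y (par y).
Proof.
move=> yo; elim: n z => [|n IH] z; last first.
  rewrite -[probT n.+2 z y]/(\sum_(w <- nbrs z) p z w * probT n.+1 w y).
  rewrite -[probT n.+1 z y]/(\sum_(w <- nbrs z) p z w * probT n w y) -sumrB.
  rewrite (eq_bigr (fun w => p z w * pn n w (par y) * p (par y) y
                             - p z w * pn n w y * p y (par y))).
    by rewrite sumrB -!mulr_suml.
  by move=> w _; rewrite -mulrBr IH mulrBr !mulrA.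
rewrite /=; have [yz|yz] := boolP (sub y z).
  have -> : (z == par y) = false.
    by apply/eqP => e; move: yz; rewrite e (par_notin_subtree Ht yo).
  (* Inside [T_y] the indicator at time 0 is 1; writing it as the total mass of one step merges both
     terms into a single sum over neighbours. *)
  rewrite mul0r sub0r -[X in _ - X](sum_p z) -sumrB.
  have [->|zy] := eqVneq z y; last first.
    rewrite mul0r oppr0 big_seq big1 // => w wz.
    have := in_subtree_nbr Ht yz wz; rewrite (negbTE zy) andbF orbF => ->.
    by rewrite mulr1 subrr.
  rewrite mul1r -(sum_p_delta y (par y)) -sumrN !big_seq.
  apply: eq_bigr => w wz.
  have := in_subtree_nbr Ht (in_subtree_refl Ht y) wz; rewrite eqxx andbT.
  have [->|wy] /= := eqVneq w (par y).
    by rewrite (par_notin_subtree Ht yo) mulr0 mulr1 sub0r.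
  by rewrite orbF => ->; rewrite mulr0 mulr1 subrr oppr0.
have -> : (z == y) = false.
  by apply/eqP => e; move: yz; rewrite e (in_subtree_refl Ht).
rewrite mul0r !subr0; have [->|zy] := eqVneq z (par y); last first.
  rewrite mul0r big_seq big1 // => w wz.
  by rewrite (nbr_in_subtree Ht yz wz) (negbTE zy) andbF mulr0.
rewrite mul1r -(sum_p_delta (par y) y) !big_seq; apply: eq_bigr => w wz.
by rewrite (nbr_in_subtree Ht _ wz) ?eqxx ?andbT // (par_notin_subtree Ht yo).
Qed.

(** Telescoped flow. The partial Green sums make the limit in [n] explicit. *)
Lemma probTE n z y : y != o -> probT n z y = (sub y z)%:R +
  ((\sum_(k < n) pn k z (par y)) * p (par y) y - (\sum_(k < n) pn k z y) * p y (par y)).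
Proof.
move=> yo; elim: n => [|n IH]; first by rewrite !big_ord0 !mul0r subrr addr0.
rewrite -[LHS](subrK (probT n z y)) probT_flow // IH !big_ord_recr /=; ring.
Qed.

(** A path from [T_x] to [w] outside it must visit [par x]; [k] is the time of the first visit.
    Allowing [z == par x] makes the hypothesis on [z] stable under a step, as the induction
    requires. *)
Lemma pn_first_passage x w n z : x != o -> ~~ sub x w -> sub x z || (z == par x) ->
  pn n z w = \sum_(k < n.+1) fpn k z (par x) * pn (n - k) (par x) w.
Proof.
move=> xo xw; elim: n z => [|n IH] z.
  move=> zx; rewrite big_ord_recl big_ord0 addr0 /=.
  have [->|zp] := eqVneq z (par x); first by rewrite mul1r.
  rewrite mul0r; case: eqP => // e; move: zx.
  by rewrite e (negbTE xw) -e (negbTE zp).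
have [->|zp] := eqVneq z (par x).
  move=> _; rewrite big_ord_recl big1 ?addr0 => [|k _]; last by rewrite /= eqxx mul0r.
  have f0 : fpn 0 (par x) (par x) = 1 by rewrite /= eqxx.
  by rewrite f0 mul1r subn0.
rewrite orbF => xz; rewrite big_ord_recl.
rewrite [fpn _ _ _]/= (negbTE zp) mul0r add0r [pn n.+1 z w]/=.
rewrite (eq_bigr (fun k : 'I_n.+1 =>
   \sum_(u <- nbrs z) p z u * (fpn k u (par x) * pn (n - k) (par x) w))); last first.
  move=> k _; rewrite /= (negbTE zp) subSS mulr_suml.
  by apply: eq_bigr => u _; rewrite mulrA.
rewrite exchange_big !big_seq; apply: eq_bigr => u uz /=.
rewrite -mulr_sumr IH //.
have := in_subtree_nbr Ht xz uz; case: (u == par x); first by rewrite orbT.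
by rewrite orbF => ->.
Qed.

Hypothesis Htr : transient o par ch p.

Lemma pn_nneseries x y : (\sum_(0 <= n <oo) (pn n x y)%:E)%E = (green x y)%:E.
Proof.
rewrite /green fineK // ge0_fin_numE ?Htr //.
by apply: nneseries_ge0 => n _ _; rewrite lee_fin pn_ge0.
Qed.

Lemma green_cvg x y : \sum_(k < n) pn k x y @[n --> \oo] --> green x y.
Proof.
have : (\sum_(0 <= k < n) (pn k x y)%:E)%E @[n --> \oo] --> (green x y)%:E.
  rewrite -pn_nneseries; apply: is_cvg_nneseries => n _ _.
  by rewrite lee_fin pn_ge0.
move/fine_cvg; apply: cvg_trans; apply: near_eq_cvg; near=> n.
by rewrite /= sumEFin /= big_mkord.
Unshelve. all: by end_near. Qed.

Lemma pn_le_green n x y : pn n x y <= green x y.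
Proof.
rewrite -lee_fin -pn_nneseries.
apply: le_trans (nneseries_lim_ge n.+1 _); last by move=> k _ _; rewrite lee_fin pn_ge0.
rewrite sumEFin lee_fin big_nat_recr //= lerDr.
by apply: sumr_ge0 => k _; exact: pn_ge0.
Qed.

(** Walking straight to the root takes [dep x] steps, which makes [G(x,o)] positive. *)
Lemma pn_dep_gt0 x : 0 < pn (dep x) x o.
Proof.
move e : (dep x) => n; elim: n x e => [|n IH] x e /=.
  by move/eqP: e; rewrite (dep_eq0 Ht) => /eqP ->; rewrite eqxx ltr01.
have xo : x != o by rewrite -(dep_eq0 Ht) e.
have ap : adj ch x (par x) by rewrite adj_sym adj_par.
rewrite (bigD1_seq (par x)) ?(nbrs_uniq Ht) ?(nbrsE Ht) //= ltr_pwDl //.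
  by rewrite mulr_gt0 ?p_gt0 // IH //; move: e; rewrite (dep_par Ht xo) => -[].
by apply: sumr_ge0 => z _; rewrite mulr_ge0 ?p_ge0 ?pn_ge0.
Qed.

Lemma green_root_gt0 x : 0 < green x o.
Proof. exact: lt_le_trans (pn_dep_gt0 x) (pn_le_green _ _ _). Qed.

Lemma green_reversible x y : mass x * green x y = mass y * green y x.
Proof.
have gc a u v : a * \sum_(k < n) pn k u v @[n --> \oo] --> a * green u v.
  by apply: cvgM; [exact: cvg_cst|exact: green_cvg].
apply: cvgn_uniq (gc _ _ _) _.
rewrite (_ : (fun n => _) = (fun n => mass y * \sum_(k < n) pn k y x)) //.
by apply/funext => n; rewrite !mulr_sumr; apply: eq_bigr => k _; exact: pn_reversible.
Qed.

(** The convolution of [pn_first_passage] summed over [n]. It is stated in the extended reals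
    because the finiteness of the first-passage series is deduced from it. *)
Lemma fpn_nneseries_green x w : x != o -> ~~ sub x w ->
  (green x w)%:E = ((\sum_(0 <= n <oo) (fpn n x (par x))%:E) * (green (par x) w)%:E)%E.
Proof.
move=> xo xw; have fe0 k : (0 <= (fpn k x (par x))%:E)%E by rewrite lee_fin fpn_ge0.
(* The triangular array is padded by 0 for [k > n], so that the two infinite sums can be
   interchanged. *)
pose a n k : \bar R :=
  if (k <= n)%N then (fpn k x (par x) * pn (n - k) (par x) w)%:E else 0%E.
have a0 i j : (0 <= a i j)%E.
  by rewrite /a; case: ifP => // _; rewrite lee_fin mulr_ge0 ?fpn_ge0 ?pn_ge0.
rewrite -pn_nneseries (eq_eseriesr (g := fun n => (\sum_(0 <= k <oo) a n k)%E)).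
  rewrite nneseries_interchange // muleC -nneseriesZl //.
  apply: eq_eseriesr => k _.
  rewrite (nneseries_split 0 k) ?add0n => [|//].
  rewrite big_nat_cond big1 ?add0e; last first.
    by move=> i /andP[/andP[_ ik] _]; rewrite /a leqNgt ik.
  rewrite -nneseries_addn // muleC -pn_nneseries -nneseriesZl; last first.
    by move=> i _; rewrite lee_fin pn_ge0.
  by apply: eq_eseriesr => i _; rewrite /a leq_addl addnK EFinM.
move=> n _; rewrite (pn_first_passage n xo xw) ?(in_subtree_refl Ht) //.
rewrite (nneseries_split 0 n.+1) // add0n [X in (_ + X)%E]eseries0 ?adde0.
  rewrite big_mkord -sumEFin; apply: eq_bigr => k _.
  by rewrite /a -ltnS ltn_ord.
by move=> i ni _; rewrite /a leqNgt ni.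
Qed.

Lemma hitF_green x w : x != o -> ~~ sub x w -> green x w = hitF x (par x) * green (par x) w.
Proof.
move=> xo xw; have sx := par_notin_subtree Ht xo.
have xo' : ~~ sub x o by rewrite (in_subtree_rootr Ht).
have f0 : (0 <= \sum_(0 <= n <oo) (fpn n x (par x))%:E)%E.
  by apply: nneseries_ge0 => n _ _; rewrite lee_fin fpn_ge0.
(* An infinite series times the positive number [G(par x, o)] would make [G(x,o)] infinite. The
   target [o] is chosen because positivity is known there. *)
have fin : (\sum_(0 <= n <oo) (fpn n x (par x))%:E)%E \is a fin_num.
  rewrite ge0_fin_numE // ltNge; apply/negP; rewrite leye_eq => /eqP e.
  have := fpn_nneseries_green xo xo'.
  by rewrite e gt0_mulye ?lte_fin ?green_root_gt0.
apply: EFin_inj; rewrite (fpn_nneseries_green xo xw) EFinM.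
by congr (_ * _)%E; rewrite fineK //; exact: fin.
Qed.

(** Comparing the targets [w] and [o] eliminates [hitF]: the passage probability becomes a ratio of
    values of the potential. *)
Lemma green_passage x w : x != o -> ~~ sub x w ->
  green x w = green x o / green (par x) o * green (par x) w.
Proof.
move=> xo xw; have xo' : ~~ sub x o by rewrite (in_subtree_rootr Ht).
by rewrite (hitF_green xo xw) (hitF_green xo xo') mulfK // gt_eqF ?green_root_gt0.
Qed.

(** The dual of [green_passage]: to reach [w] in [T_x] from [o], the walk passes through [x]. By
    reversibility it says that [G(y,x) / G(y,o)] is constant for [y] in [T_x], which follows by
    descending from [x] with [green_passage] at each vertex. *)
Lemma green_subtree x w : sub x w -> green x w = green x x / green o x * green o w.
Proof.
have gm y : green o y = mass y * green y o.
  by rewrite -green_reversible mass_root mul1r.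
have mx := mass_gt0 x; have gx := green_root_gt0 x.
suff key y : sub x y -> green y x / green y o = green x x / green x o.
  move=> xw; have mw := mass_gt0 w; have gw := green_root_gt0 w.
  have e : green x w = mass w * green w x / mass x.
    by rewrite -green_reversible mulrAC mulfV ?mul1r // gt_eqF.
  have /(congr1 ( *%R^~ (green w o))) := key _ xw; rewrite divfK ?gt_eqF // => ew.
  by rewrite e ew !gm invfM; ring.
move e : (dep y - dep x)%N => n; elim: n y e => [|n IH] y e xy.
  by rewrite (in_subtree_same_dep Ht xy) //; have := in_subtree_dep Ht xy; lia.
have yo : y != o by rewrite -(dep_eq0 Ht); lia.
have yx : y != x by apply/eqP => yx; move: e; rewrite yx subnn.
have xp : sub x (par y) by move: xy; rewrite (in_subtree_par Ht) // (negbTE yx).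
have yNx : ~~ sub y x.
  by apply: contra yx => yx; rewrite (in_subtree_anti Ht yx xy).
have gp := green_root_gt0 (par y); have gy := green_root_gt0 y.
rewrite -(IH (par y)) //; last by move: e; rewrite (dep_par Ht yo); lia.
by rewrite green_passage //; field; rewrite !gt_eqF.
Qed.

Hypothesis HF : forall x, x != o -> hitF x (par x) < 1.

(** Here the assumption [F(x,x^-) < 1] enters; it gives the ultrametric monotonicity and the
    positivity of [nu o] on every cell. *)
Lemma green_par_lt x : x != o -> green x o < green (par x) o.
Proof.
move=> xo; rewrite (hitF_green (w := o) xo); last by rewrite (in_subtree_rootr Ht).
by rewrite gtr_pMl ?HF // green_root_gt0.
Qed.

Context {nu : V -> probability (Ends V) R}.
Hypothesis Hnu : is_limit_distribution o par ch dep p nu.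

Lemma nu_bdry x : nu x (bdry o ch) = 1%E. Proof. by case: (Hnu x). Qed.

(** The limit of [probTE]: the starting indicator plus the expected net number of crossings into
    [T_y]. *)
Lemma nu_bdry_sub z y : y != o -> nu z (bdry_sub o ch dep y) =
  ((sub y z)%:R + (green z (par y) * p (par y) y - green z y * p y (par y)))%:E.
Proof.
move=> yo; have [_ /(_ y) c] := Hnu z; apply: (ecvgn_uniq c).
apply: cvg_EFin; first by near=> n.
rewrite [X in X @ _ --> _](_ : _ = (fun n => (sub y z)%:R +
  ((\sum_(k < n) pn k z (par y)) * p (par y) y - (\sum_(k < n) pn k z y) * p y (par y)))).
  apply: cvgD; first exact: cvg_cst.
  by apply: cvgB; (apply: cvgM; [exact: green_cvg|exact: cvg_cst]).
by apply/funext => n /=; rewrite -probTE.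
Unshelve. all: by end_near. Qed.

Lemma bdry_sub_root : bdry_sub o ch dep o = bdry o ch.
Proof. by apply/seteqP; split => [r []//|r rr]; split=> //; rewrite (dep_root Ht); case: rr. Qed.

Lemma nu_bdry_sub_root x : nu x (bdry_sub o ch dep o) = 1%E.
Proof. by rewrite bdry_sub_root nu_bdry. Qed.

Lemma nu_root_cond x : x != o ->
  nu o (bdry_sub o ch dep x) = (cond x * (green (par x) o - green x o))%:E.
Proof.
move=> xo; have gm y : green o y = mass y * green y o.
  by rewrite -green_reversible mass_root mul1r.
rewrite nu_bdry_sub // (in_subtree_rootr Ht) (negbTE xo) add0r !gm /cond.
by rewrite mulrAC (mass_balance (adj_par xo)); congr (_%:E); ring.
Qed.

Lemma nu_root_gt0 x : (0 < nu o (bdry_sub o ch dep x))%E.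
Proof.
have [->|xo] := eqVneq x o; first by rewrite nu_bdry_sub_root.
by rewrite nu_root_cond // lte_fin mulr_gt0 ?cond_gt0 // subr_gt0 green_par_lt.
Qed.

End Walk.

(** * Energy identities on a weighted tree *)

Section LevelSums.
Context {V : pointedType} {o : V} {par : V -> V} {ch : V -> seq V} {dep : V -> nat}.
Hypothesis Ht : is_rooted_tree o par ch dep.
Local Notation sub := (in_subtree par dep).
Local Notation anc := (anc par dep).

Lemma big_level_pick (R : nmodType) n (P : pred V) x (F : V -> R) :
  (forall y, P y && (dep y == n) = (y == x)) ->
  \sum_(y <- level o ch n | P y) F y = F x.
Proof.
move=> Px; rewrite -big_filter (_ : [seq y <- _ | _] = [:: x]) ?big_seq1 //.
apply: perm_small_eq => //; apply: uniq_perm => // [|y].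
  exact/filter_uniq/(level_uniq Ht).
by rewrite mem_filter (mem_level Ht) Px inE.
Qed.

Lemma big_level_anc (R : nmodType) k z (F : V -> R) : (k <= dep z)%N ->
  \sum_(x <- level o ch k | sub x z) F x = F (anc k z).
Proof.
move=> kz; apply: big_level_pick => x; rewrite (in_subtreeE Ht).
have [->|xz] := eqVneq x (anc k z); first by rewrite (dep_anc Ht) // kz !eqxx.
by have [dx|_] := eqVneq (dep x) k; rewrite ?andbF // dx eq_sym (negbTE xz) andbF.
Qed.

Lemma big_level_dep (R : nmodType) x (F : V -> R) :
  \sum_(y <- level o ch (dep x) | sub x y) F y = F x.
Proof.
apply: big_level_pick => y; have [->|yx] := eqVneq y x.
  by rewrite (in_subtree_refl Ht) eqxx.
apply/negbTE/negP => /andP[s /eqP d].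
by rewrite (in_subtree_same_dep Ht s d) eqxx in yx.
Qed.

Lemma big_levelS_sub (R : nmodType) x N (F : V -> R) : (dep x <= N)%N ->
  \sum_(y <- level o ch N.+1 | sub x y) F y =
  \sum_(z <- level o ch N | sub x z) \sum_(y <- ch z) F y.
Proof.
move=> xN; rewrite big_mkcond big_levelS [RHS]big_mkcond !big_seq.
apply: eq_bigr => z; rewrite (mem_level Ht) => /eqP dz.
rewrite big_seq; case: ifPn => xz.
  by rewrite [RHS]big_seq; apply: eq_bigr => y yz; rewrite (in_subtree_ch Ht _ yz) xz orbT.
rewrite big1 // => y yz; rewrite (in_subtree_ch Ht _ yz) (negbTE xz) orbF.
by case: eqP => // e; move: xN; rewrite -e (dep_ch Ht yz) dz ltnn.
Qed.

End LevelSums.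

(** * Currents, energy and the boundary term *)

Section Potential.
Context {V : pointedType} {o : V} {par : V -> V} {ch : V -> seq V} {dep : V -> nat}.
Hypothesis Ht : is_rooted_tree o par ch dep.
Context {R : realType} (A G X h : V -> R).
Hypothesis A_ge0 : forall x, 0 <= A x.
Hypothesis A_ch : forall x, \sum_(y <- ch x) A y = A x.
Hypothesis G_gt0 : forall x, 0 < G x.
Hypothesis G_par : forall x, x != o -> G x < G (par x).
Hypothesis AX_ch : forall x, \sum_(y <- ch x) A y * X y = A x * X x.
Hypothesis h_root : h o = X o.
Hypothesis h_par : forall x, x != o ->
  h x = G x / G (par x) * h (par x) + (1 - G x / G (par x)) * X x.
Local Notation sub := (in_subtree par dep).
Local Notation level := (level o ch).
Local Notation anc := (anc par dep).

(** Current through the edge above [x] per unit of harmonic measure. *)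
Let M x := (X x - h x) / G x.

Lemma current_root : M o = 0. Proof. by rewrite /M h_root subrr mul0r. Qed.

(** Increments of [M] are those of [X] divided by [G] at the parent, so [M] inherits the martingale
    property of the averages. *)
Lemma current_ch x y : y \in ch x -> M y = M x + (X y - X x) / G x.
Proof.
move=> yx; have yo := ch_neq_root Ht yx; have Gx := G_gt0 x; have Gy := G_gt0 y.
by rewrite /M (h_par yo) (par_ch Ht yx); field; rewrite !gt_eqF.
Qed.

Lemma harmonic_increment x y : y \in ch x -> h y - h x = (G x - G y) * M y.
Proof.
move=> yx; have yo := ch_neq_root Ht yx; have Gx := G_gt0 x; have Gy := G_gt0 y.
by rewrite /M (h_par yo) (par_ch Ht yx); field; rewrite !gt_eqF.
Qed.

Lemma current_balance x : \sum_(y <- ch x) A y * M y = A x * M x.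
Proof.
rewrite big_seq (eq_bigr (fun y => A y * M x + (A y * X y - A y * X x) / G x)); last first.
  by move=> y yx; rewrite (current_ch yx) mulrDr mulrA mulrBr.
rewrite -big_seq big_split /= -!mulr_suml sumrB -mulr_suml A_ch AX_ch.
by rewrite subrr mul0r addr0.
Qed.

Lemma current_variance x :
  \sum_(y <- ch x) A y * (M y - M x) ^+ 2 = \sum_(y <- ch x) A y * M y ^+ 2 - A x * M x ^+ 2.
Proof.
rewrite (eq_bigr (fun y => A y * M y ^+ 2 - (M x *+ 2 * (A y * M y) - M x ^+ 2 * A y))).
  rewrite sumrB; congr (_ - _); rewrite sumrB -!mulr_sumr A_ch current_balance.
  by rewrite mulr2n; ring.
by move=> y _; ring.
Qed.

(** The weight [g] stays free, while [M] is always built from [G]: both [g = G] and the truncated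
    potential [max (G - eps) 0] are used. *)
Definition level_mass (g : V -> R) n := \sum_(x <- level n) A x * g x * M x ^+ 2.

Definition level_energy (g : V -> R) n :=
  \sum_(x <- level n) \sum_(y <- ch x) A y * (g x - g y) * M y ^+ 2.

(** Summation by parts over one generation, valid for every weight [g]; the remainder is the
    conditional variance of [M] weighted by [g]. *)
Lemma level_energy_mass g n : level_energy g n + level_mass g n.+1 = level_mass g n +
  \sum_(x <- level n) g x * (\sum_(y <- ch x) A y * (M y - M x) ^+ 2).
Proof.
rewrite /level_mass /level_energy big_levelS -!big_split /=; apply: eq_bigr => x _.
rewrite current_variance -big_split /=; set S := \sum_(y <- _) A y * M y ^+ 2.
have -> : A x * g x * M x ^+ 2 + g x * (S - A x * M x ^+ 2) = g x * S by ring.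
rewrite mulr_sumr.
by apply: eq_bigr => y _; ring.
Qed.

Definition jump_energy N :=
  \sum_(k < N) \sum_(x <- level k) (\sum_(y <- ch x) A y * (X y - X x) ^+ 2) / G x.

(** Summation by parts with [g = G], telescoped; no term remains at level 0 because [M] vanishes at
    the root. *)
Lemma jump_energyE N :
  jump_energy N = \sum_(k < N) level_energy G k + level_mass G N.
Proof.
rewrite /jump_energy; elim: N => [|N IH].
  rewrite !big_ord0 add0r /level_mass big_seq1.
  by rewrite current_root expr0n mulr0.
rewrite !big_ord_recr /= IH -!addrA; congr (_ + _).
rewrite level_energy_mass; congr (_ + _).
apply: eq_bigr => x _; have Gx : G x != 0 by rewrite gt_eqF.
rewrite mulr_suml mulr_sumr !big_seq; apply: eq_bigr => y yx.
by rewrite (current_ch yx); field.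
Qed.

Lemma level_energy_ge0 n : 0 <= level_energy G n.
Proof.
apply: sumr_ge0 => x _; rewrite big_seq; apply: sumr_ge0 => y yx.
apply: mulr_ge0; last exact: sqr_ge0.
apply: mulr_ge0; rewrite ?subr_ge0 //.
by have := G_par (ch_neq_root Ht yx); rewrite (par_ch Ht yx) => /ltW.
Qed.

(* Thomson's principle with the test potential [max (G - eps) 0], which is
   supported in a finite subtree so that no boundary term survives. *)
Lemma level_mass_le_tail eps n d : 0 < eps ->
  (forall x, dep x = (n + d)%N -> G x <= eps) ->
  level_mass (fun x => Num.max (G x - eps) 0) n <= \sum_(n <= k < n + d) level_energy G k.
Proof.
move=> e0; elim: d n => [|d IH] n Gn.
  rewrite addn0 big_geq // /level_mass big_seq big1 // => x.
  rewrite (mem_level Ht) => /eqP dx.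
  have Gx : G x <= eps by apply: Gn; rewrite addn0.
  by rewrite max_r ?mulr0 ?mul0r // subr_le0.
rewrite big_ltn; last by lia.
rewrite addnS -addSn; apply: (@le_trans _ _
   (level_energy (fun x => Num.max (G x - eps) 0) n +
    level_mass (fun x => Num.max (G x - eps) 0) n.+1)).
  (* Dropping the nonnegative variance term bounds the level mass at [n] by the energy of that
     generation plus the level mass at [n.+1]. *)
  rewrite level_energy_mass lerDl; apply: sumr_ge0 => x _.
  rewrite mulr_ge0 ?le_max ?lexx ?orbT //.
  by apply: sumr_ge0 => y _; rewrite mulr_ge0 // sqr_ge0.
apply: lerD; last by apply: IH => x dx; apply: Gn; rewrite dx addSnnS.
apply: ler_sum => x _; rewrite big_seq [leRHS]big_seq; apply: ler_sum => y yx.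
apply: ler_wpM2r; rewrite ?sqr_ge0 //; apply: ler_wpM2l => //.
have := G_par (ch_neq_root Ht yx); rewrite (par_ch Ht yx) => Gxy.
(* [max (t - eps) 0] is nondecreasing and 1-Lipschitz in [t], so the test potential drops along an
   edge by no more than [G] does. *)
by case: (leP 0 (G x - eps)) => ?; case: (leP 0 (G y - eps)) => ?; lra.
Qed.

Hypothesis G_vanishes : forall eps, 0 < eps -> exists K, forall x, (K <= dep x)%N -> G x < eps.

(** At a fixed level, replacing [G] by [max (G - eps) 0] costs at most [eps * c], which disappears
    as [eps] tends to 0; the tail bound is uniform in [eps]. *)
Lemma level_mass_le_lim n (L : R) :
  \sum_(k < N) level_energy G k @[N --> \oo] --> L ->
  level_mass G n <= L - \sum_(k < n) level_energy G k.
Proof.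
move=> cL; set c := \sum_(x <- level n) A x * M x ^+ 2.
have c0 : 0 <= c by apply: sumr_ge0 => x _; rewrite mulr_ge0 // sqr_ge0.
have nd : nondecreasing_seq (fun N => \sum_(k < N) level_energy G k).
  by apply/nondecreasing_seqP => N; rewrite big_ord_recr /= lerDl level_energy_ge0.
have leL N : \sum_(k < N) level_energy G k <= L.
  by rewrite -(cvg_lim _ cL) //; apply: nondecreasing_cvgn_le => //; apply/cvg_ex; exists L.
(* The summand 1 keeps the denominator positive when [c = 0] and still gives [eps * c <= e]. *)
apply/ler_addgt0Pr => e e0; set eps := e / (c + 1).
have eps0 : 0 < eps by rewrite divr_gt0 // ltr_wpDl.
have [K GK] := G_vanishes eps0.
have GnK x : dep x = (n + K)%N -> G x <= eps.
  by move=> dx; apply/ltW/GK; rewrite dx leq_addl.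
have := level_mass_le_tail eps0 GnK.
have -> : \sum_(n <= k < n + K) level_energy G k =
    \sum_(k < n + K) level_energy G k - \sum_(k < n) level_energy G k.
  rewrite -!(big_mkord xpredT (level_energy G)).
  by rewrite (@big_cat_nat _ _ _ n 0 (n + K)) ?leq_addr //= addrAC subrr add0r.
have : level_mass G n - eps * c <= level_mass (fun x => Num.max (G x - eps) 0) n.
  rewrite /level_mass /c mulr_sumr -sumrB; apply: ler_sum => x _.
  have -> : A x * G x * M x ^+ 2 - eps * (A x * M x ^+ 2) =
            A x * M x ^+ 2 * (G x - eps) by ring.
  rewrite [A x * Num.max _ _ * _]mulrAC; apply: ler_wpM2l.
    by rewrite mulr_ge0 ?sqr_ge0.
  by rewrite le_max lexx.
have : eps * c <= e.
  by rewrite /eps mulrAC ler_pdivrMr ?ltr_wpDl // ler_pM2l // lerDl.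
by have := leL (n + K)%N; lra.
Qed.

(** By [jump_energyE] the sequence exceeds the partial energies by the boundary term, and that term
    is at most the energy still missing to [L]. *)
Lemma jump_energy_cvg (L : R) :
  \sum_(k < N) level_energy G k @[N --> \oo] --> L -> jump_energy @ \oo --> L.
Proof.
move=> cL; apply: (squeeze_cvgr _ cL (cvg_cst L)); near=> N.
rewrite jump_energyE lerDl; apply/andP; split.
  apply: sumr_ge0 => x _; apply: mulr_ge0; last exact: sqr_ge0.
  by rewrite mulr_ge0 // ltW.
by rewrite -lerBrDl level_mass_le_lim.
Unshelve. all: by end_near. Qed.

Lemma harmonic_energyE (c : V -> R) n :
  (forall x, x != o -> c x * (G (par x) - G x) = A x) ->
  \sum_(x <- level n.+1) (h x - h (par x)) * (h x - h (par x)) * c x = level_energy G n.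
Proof.
move=> cA; rewrite big_levelS /level_energy; apply: eq_bigr => x _.
rewrite big_seq [RHS]big_seq; apply: eq_bigr => y yx.
have := cA _ (ch_neq_root Ht yx); rewrite (par_ch Ht yx) (harmonic_increment yx) => <-.
by ring.
Qed.

(* [rate x] is the increment at [x] of the reciprocal of [G] along the geodesic
   from the root, so that the rates along that geodesic sum to [(G x)^-1]. *)
Definition rate x := (G x)^-1 - (if x == o then 0 else (G (par x))^-1).

Lemma rate_ge0 x : 0 <= rate x.
Proof.
rewrite /rate; have [_|xo] := eqVneq x o; first by rewrite subr0 invr_ge0 ltW.
by rewrite subr_ge0 lef_pV2 ?posrE // ltW // G_par.
Qed.

Lemma sum_rate x : \sum_(k < (dep x).+1) rate (anc k x) = (G x)^-1.
Proof.
move e : (dep x) => n; elim: n x e => [|n IH] x e.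
  have /eqP xo : x == o by rewrite -(dep_eq0 Ht) e.
  by rewrite big_ord1 (anc0 Ht) xo /rate eqxx subr0.
have xo : x != o by rewrite -(dep_eq0 Ht) e.
have ep : dep (par x) = n by move: e; rewrite (dep_par Ht xo) => -[].
rewrite big_ord_recr /= -[X in anc X x]e anc_dep.
rewrite (eq_bigr (fun k : 'I_n.+1 => rate (anc k (par x)))); last first.
  by move=> k _; rewrite (anc_par Ht xo) // e.
by rewrite IH // /rate (negbTE xo); ring.
Qed.

(** For averages [X] of [f] this is the integral over the cell of [x] of the squared conditional
    expectation of [f] given the vertex at depth [N]. *)
Definition level_square x N := \sum_(y <- level N | sub x y) A y * X y ^+ 2.

Definition level_var k N := \sum_(x <- level k) rate x * (level_square x N - A x * X x ^+ 2).

Let D z := \sum_(y <- ch z) A y * X y ^+ 2 - A z * X z ^+ 2.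

Lemma varianceE z : \sum_(y <- ch z) A y * (X y - X z) ^+ 2 = D z.
Proof.
rewrite (eq_bigr (fun y => A y * X y ^+ 2 - (X z *+ 2 * (A y * X y) - X z ^+ 2 * A y))).
  rewrite sumrB; congr (_ - _); rewrite sumrB -!mulr_sumr A_ch AX_ch.
  by rewrite mulr2n; ring.
by move=> y _; ring.
Qed.

Lemma level_squareS x N : (dep x <= N)%N ->
  level_square x N.+1 = level_square x N + \sum_(z <- level N | sub x z) D z.
Proof.
move=> xN; rewrite /level_square (big_levelS_sub Ht) // -big_split /=.
by apply: eq_bigr => z _; rewrite addrC subrK.
Qed.

Lemma level_square_le x m n : (dep x <= m <= n)%N -> level_square x m <= level_square x n.
Proof.
move=> /andP[xm /subnK <-]; elim: (n - m)%N => [//|d IH].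
rewrite addSn level_squareS; last by rewrite (leq_trans xm) // leq_addl.
apply: (le_trans IH); rewrite lerDl; apply: sumr_ge0 => z _; rewrite -varianceE.
by apply: sumr_ge0 => y _; rewrite mulr_ge0 // sqr_ge0.
Qed.

Lemma level_square_dep x : level_square x (dep x) = A x * X x ^+ 2.
Proof. by rewrite /level_square (big_level_dep Ht). Qed.

Lemma level_var_ge0 k N : (k <= N)%N -> 0 <= level_var k N.
Proof.
move=> kN; rewrite /level_var big_seq; apply: sumr_ge0 => x; rewrite (mem_level Ht) => /eqP dx.
rewrite mulr_ge0 ?rate_ge0 // subr_ge0 -level_square_dep level_square_le //.
by rewrite dx leqnn.
Qed.

Lemma level_varS k N : (k <= N)%N ->
  level_var k N.+1 = level_var k N + \sum_(z <- level N) rate (anc k z) * D z.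
Proof.
move=> kN.
have -> : \sum_(z <- level N) rate (anc k z) * D z =
          \sum_(z <- level N) \sum_(x <- level k | sub x z) rate x * D z.
  rewrite !big_seq; apply: eq_bigr => z; rewrite (mem_level Ht) => /eqP dz.
  by rewrite (big_level_anc Ht (fun x => rate x * D z)) ?dz.
rewrite (exchange_big_dep xpredT) //= /level_var -big_split /= !big_seq.
apply: eq_bigr => x; rewrite (mem_level Ht) => /eqP dx.
by rewrite -mulr_sumr -mulrDr level_squareS ?dx // addrAC.
Qed.

(** Expanding [1 / G z] into the rates along the geodesic to [z] charges the squared increment at
    [z] to each ancestor of [z]; collecting by ancestor yields variances over subtrees. *)
Lemma jump_energy_var N : jump_energy N = \sum_(k < N) level_var k N.
Proof.
rewrite /jump_energy; elim: N => [|N IH]; first by rewrite !big_ord0.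
rewrite big_ord_recr /= IH.
rewrite (eq_bigr (fun k : 'I_N.+1 => level_var k N +
    \sum_(z <- level N) rate (anc k z) * D z)); last first.
  by move=> k _; rewrite level_varS // -ltnS.
(* At depth [N] each subtree contains one vertex of that level, so the new summand [k = N]
   contributes only its increment. *)
have v0 : level_var N N = 0.
  rewrite /level_var big_seq big1 // => x; rewrite (mem_level Ht) => /eqP <-.
  by rewrite level_square_dep subrr mulr0.
rewrite big_split /= big_ord_recr /= v0 addr0; congr (_ + _).
rewrite exchange_big !big_seq; apply: eq_bigr => z.
rewrite (mem_level Ht) => /eqP dz.
by rewrite varianceE -mulr_suml -dz sum_rate mulrC.
Qed.

(** Only the summand [k = 0] of [jump_energy_var] is kept; its rate is [1 / G o]. This is the source
    of square integrability. *)
Lemma level_square_root_bound (L : R) : (forall N, jump_energy N <= L) ->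
  forall N, level_square o N <= G o * L + A o * X o ^+ 2.
Proof.
move=> VL N; have Go := G_gt0 o.
(* Passing to [N.+1] guarantees that the summand [k = 0] exists. *)
apply: (@le_trans _ _ (level_square o N.+1)).
  by apply: level_square_le; rewrite (dep_root Ht) leq0n leqnSn.
rewrite -lerBlDr -ler_pdivrMl //; apply: le_trans (VL N.+1).
rewrite jump_energy_var big_ord_recl.
have -> : level_var 0 N.+1 = (G o)^-1 * (level_square o N.+1 - A o * X o ^+ 2).
  by rewrite /level_var big_seq1 /rate eqxx subr0.
rewrite lerDl.
by apply: sumr_ge0 => k _; apply/level_var_ge0/ltnW/ltn_ord.
Qed.

(** Both the summands and the range of summation in [jump_energy_var] depend on [N]. Monotonicity
    separates the two limits: the limiting terms dominate each summand, while their finite sums stay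
    below [L]. *)
Lemma level_var_series (L : R) (Q : V -> R) : jump_energy @ \oo --> L ->
  (forall x, level_square x @ \oo --> Q x) ->
  \sum_(k < N) \sum_(x <- level k) rate x * (Q x - A x * X x ^+ 2) @[N --> \oo] --> L.
Proof.
move=> cL cQ; set r := fun k => \sum_(x <- level k) rate x * (Q x - A x * X x ^+ 2).
have squareQ x N : (dep x <= N)%N -> level_square x N <= Q x.
  move=> xN; rewrite -(cvg_lim _ (cQ x)) //; apply: limr_ge.
    by apply/cvg_ex; exists (Q x).
  by near=> m; apply: level_square_le; rewrite xN; near: m; exact: nbhs_infty_ge.
have varr k N : (k <= N)%N -> level_var k N <= r k.
  move=> kN; rewrite /level_var /r !big_seq; apply: ler_sum => x.
  rewrite (mem_level Ht) => /eqP dx; rewrite ler_wpM2l ?rate_ge0 // lerB //.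
  by rewrite squareQ ?dx.
have cvar k : level_var k @ \oo --> r k.
  rewrite /level_var /r; elim: (level k) => [|x s IHs].
    by under eq_fun => N do rewrite big_nil; rewrite big_nil; exact: cvg_cst.
  under eq_fun => N do rewrite big_cons; rewrite big_cons; apply: cvgD => //.
  by apply: cvgM; [exact: cvg_cst|apply: cvgB; [exact: cQ|exact: cvg_cst]].
(* With [K] fixed, the levels from [K] on contribute nonnegative terms and may be discarded before
   [N] tends to infinity. *)
have rL K : \sum_(k < K) r k <= L.
  have c : \sum_(k < K) level_var k N @[N --> \oo] --> \sum_(k < K) r k.
    elim: K => [|K IHK].
      by under eq_fun => N do rewrite big_ord0; rewrite big_ord0; exact: cvg_cst.
    under eq_fun => N do rewrite big_ord_recr /=; rewrite big_ord_recr /=.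
    by apply: cvgD.
  rewrite -(cvg_lim _ cL) // -(cvg_lim _ c) //; apply: ler_lim.
  - by apply/cvg_ex; exists (\sum_(k < K) r k).
  - by apply/cvg_ex; exists L.
  near=> N; rewrite jump_energy_var.
  have /subnK <- : (K <= N)%N by near: N; exact: nbhs_infty_ge.
  rewrite addnC big_split_ord /= lerDl; apply: sumr_ge0 => k _.
  by apply: level_var_ge0; have := ltn_ord k; lia.
apply: (squeeze_cvgr _ cL (cvg_cst L)); near=> N; rewrite rL andbT jump_energy_var.
by apply: ler_sum => k _; apply/varr/ltnW.
Unshelve. all: by end_near. Qed.

End Potential.

Arguments level_energy {V} o ch {R} A G X h g.
Arguments jump_energy {V} o ch {R} A G X.
Arguments rate {V} o par {R} G.
Arguments level_square {V} o par ch dep {R} A X.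

(** * Measures on the end space *)

Section EndMeasure.
Context {V : pointedType} {o : V} {par : V -> V} {ch : V -> seq V} {dep : V -> nat}.
Hypothesis Ht : is_rooted_tree o par ch dep.
Local Notation sub := (in_subtree par dep).
Local Notation anc := (anc par dep).
Local Notation level := (level o ch).
Local Notation bd := (bdry o ch).
Local Notation B := (bdry_sub o ch dep).

Lemma measurable_coord n (v : V) : measurable [set r : Ends V | r n = v].
Proof. by apply: sub_sigma_algebra; exists n, v. Qed.

(** Levels are finite, so being an initial geodesic segment of length [n] is a finite union of
    conditions on coordinates; this makes the set of rays measurable. *)
Lemma bdry_cylinders : bd = \bigcap_n \big[setU/set0]_(y <- level n)
  \bigcap_(k in [set k | (k <= n)%N]) [set r : Ends V | r k = anc k y].
Proof.
apply/seteqP; split => [r rr n _|r H].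
  rewrite -bigcup_seq; exists (r n) => /=; first exact: (ray_level Ht).
  by move=> k /= kn; rewrite (ray_anc Ht).
have H' n : exists2 y, dep y = n & forall k, (k <= n)%N -> r k = anc k y.
  have := H n I; rewrite -bigcup_seq => -[y /= yn Hy]; exists y => //.
  by move: yn; rewrite (mem_level Ht) => /eqP.
split; first by have [y _ /(_ 0%N) ->] := H' 0%N; rewrite // (anc0 Ht).
move=> n; have [y dy Hy] := H' n.+1.
have yo : y != o by rewrite -(dep_eq0 Ht) dy.
have dp : dep (par y) = n by move: dy; rewrite (dep_par Ht yo) => -[].
rewrite !Hy // -{1}dy anc_dep (anc_par Ht yo) ?dy // -{1}dp anc_dep.
exact: (mem_ch_par Ht yo).
Qed.

Lemma measurable_bdry : measurable bd.
Proof.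
rewrite bdry_cylinders; apply: bigcap_measurable; first by exists 0%N.
move=> n _; apply: bigsetU_measurable => y _.
apply: bigcap_measurable; first by exists 0%N.
by move=> k _; exact: measurable_coord.
Qed.

Lemma measurable_bdry_sub y : measurable (B y).
Proof.
rewrite (_ : B y = bd `&` [set r | r (dep y) = y]); last by apply/seteqP; split.
by apply: measurableI; [exact: measurable_bdry|exact: measurable_coord].
Qed.

Lemma bdry_sub_bdry y : B y `<=` bd. Proof. by move=> r []. Qed.

Lemma bdry_sub_level x n : (dep x <= n)%N ->
  B x = \big[setU/set0]_(y <- [seq y <- level n | sub x y]) B y.
Proof.
move=> xn; rewrite -bigcup_seq; apply/seteqP; split => [r [rr rx]|r [y /=]]; last first.
  by rewrite mem_filter => /andP[xy _]; exact: (bdry_sub_subset Ht).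
exists (r n); last by split=> //; rewrite (ray_dep Ht).
by rewrite /= mem_filter (ray_level Ht) // (ray_subtree Ht) // xn rx eqxx.
Qed.

Lemma bdry_sub_trivIset n (P : pred V) : trivIset [set` [seq y <- level n | P y]] B.
Proof.
move=> y z /=; rewrite !mem_filter !(mem_level Ht) => /andP[_ /eqP yn] /andP[_ /eqP zn].
by move=> [r [[_ ry] [_ rz]]]; rewrite -ry -rz yn zn.
Qed.

Lemma measurable_coord_fun (R : realType) n (u : V -> R) :
  measurable_fun bd (fun r : Ends V => u (r n)).
Proof.
move=> mbd Y mY.
rewrite (_ : _ `&` _ = \big[setU/set0]_(y <- [seq y <- level n | u y \in Y]) B y).
  by apply: bigsetU_measurable => y _; exact: measurable_bdry_sub.
rewrite -bigcup_seq; apply/seteqP; split => [r [rr Yr]|r [y /=]].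
  exists (r n); last by split=> //; rewrite (ray_dep Ht).
  by rewrite /= mem_filter (ray_level Ht) // andbT inE.
rewrite mem_filter (mem_level Ht) => /andP[Yy /eqP yn] [rr ry]; split => //.
by rewrite /= -yn ry; move: Yy; rewrite inE.
Qed.

Context {R : realType}.

Lemma ge0_integral_level (mu : {measure set (Ends V) -> \bar R}) (f : Ends V -> \bar R) x n :
  (dep x <= n)%N ->
  measurable_fun (B x) f -> (forall r, B x r -> (0 <= f r)%E) ->
  (\int[mu]_(r in B x) f r = \sum_(y <- level n | sub x y) \int[mu]_(r in B y) f r)%E.
Proof.
move=> xn mf f0; rewrite -[RHS]big_filter {1}(bdry_sub_level xn).
rewrite (bdry_sub_level xn) in mf f0.
apply: ge0_integral_bigsetU => //; first by move=> y; exact: measurable_bdry_sub.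
  exact/filter_uniq/(level_uniq Ht).
exact: bdry_sub_trivIset.
Qed.

Lemma integral_level (mu : {measure set (Ends V) -> \bar R}) (f : Ends V -> R) x n :
  (dep x <= n)%N -> measurable_fun (B x) (EFin \o f) ->
  (\int[mu]_(r in B x) (f r)%:E = \sum_(y <- level n | sub x y) \int[mu]_(r in B y) (f r)%:E)%E.
Proof.
move=> xn mf; rewrite -[RHS]big_filter {1}(bdry_sub_level xn).
rewrite (bdry_sub_level xn) in mf.
apply: integral_bigsetU_EFin => //; first by move=> y; exact: measurable_bdry_sub.
  exact/filter_uniq/(level_uniq Ht).
exact: bdry_sub_trivIset.
Qed.

Lemma measure_level (mu : {measure set (Ends V) -> \bar R}) x n : (dep x <= n)%N ->
  (mu (B x) = \sum_(y <- level n | sub x y) mu (B y))%E.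
Proof.
move=> xn; have mB := measurable_bdry_sub.
rewrite -[LHS]mul1e -(integral_cst _ (mB x)) (@ge0_integral_level _ (cst 1%E) _ n) //.
by apply: eq_bigr => y _; rewrite integral_cst // mul1e.
Qed.

Lemma measure_ch (mu : {measure set (Ends V) -> \bar R}) x :
  (mu (B x) = \sum_(y <- ch x) mu (B y))%E.
Proof. by rewrite (@measure_level mu x (dep x).+1) // (big_level_ch Ht). Qed.

(** Uniqueness on a pi-system. The sigma-algebra lives on all sequences of vertices, so the system
    consists of finite lists of coordinate conditions; these become finite disjoint unions of cells
    only after intersecting with the rays. *)
Lemma ends_measure_unique (m1 m2 : {measure set (Ends V) -> \bar R}) :
  (m1 (~` bd) = 0)%E -> (m2 (~` bd) = 0)%E -> (m1 bd < +oo)%E ->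
  (forall y, m1 (B y) = m2 (B y)) -> forall A, measurable A -> m1 A = m2 A.
Proof.
move=> m10 m20 m1oo m12.
have mbd := measurable_bdry; have mB := measurable_bdry_sub.
have restrict (m : {measure set (Ends V) -> \bar R}) A :
    (m (~` bd) = 0)%E -> measurable A -> m A = m (A `&` bd).
  move=> m0 mA; rewrite -[A in LHS](setUIDK A bd).
  rewrite measureU; [|exact: measurableI|exact: measurableD|].
  - rewrite [X in (_ + X)%E](_ : _ = 0%E) ?adde0 //.
    apply: (subset_measure0 (measurableD mA mbd) (measurableC mbd) _ m0).
    by move=> r [].
  - by apply/seteqP; split => // r [[_ ?] [_ ?]].
pose C (L : seq (nat * V)) : set (Ends V) := [set r | forall c, c \in L -> r c.1 = c.2].
pose G := [set A | exists L, A = C L].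
have CI L L' : C (L ++ L') = C L `&` C L'.
  apply/seteqP; split => [r H|r [H H'] c].
    by split => c cL; apply: H; rewrite mem_cat cL ?orbT.
  by rewrite mem_cat => /orP[/H|/H'].
have mC L : measurable (C L).
  elim: L => [|c L IH].
    by rewrite (_ : C [::] = setT) //; apply/seteqP; split.
  rewrite -cat1s CI; apply: measurableI => //.
  rewrite (_ : C _ = [set r | r c.1 = c.2]); first exact: measurable_coord.
  apply/seteqP; split => [r|r rc d]; first by apply; rewrite inE.
  by rewrite inE => /eqP ->.
have m1T : (m1 setT < +oo)%E by rewrite (restrict _ setT) // setTI.
apply: (measure_unique G (fun=> setT)).
- apply/seteqP; split; last first.
    apply: smallest_sub; first exact: sigma_algebra_measurable.
    by move=> _ [L ->]; exact: mC.
  apply: smallest_sub; first exact: smallest_sigma_algebra.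
  move=> _ [n [v ->]]; apply: sub_sigma_algebra; exists [:: (n, v)].
  apply/seteqP; split => [r rv c|r]; first by rewrite inE => /eqP ->.
  by move/(_ (n, v)); apply; rewrite inE.
- by move=> _ _ [L ->] [L' ->]; exists (L ++ L').
- by move=> _; exists [::]; apply/seteqP; split.
- by rewrite bigcup_const //; exists 0%N.
- move=> _ [L ->]; rewrite [LHS]restrict // [RHS]restrict //.
  (* Every condition in [L] concerns a coordinate up to [n], so on a ray it is decided by the vertex
     at depth [n]. *)
  set n := \max_(c <- L) c.1.
  have Ln c : c \in L -> (c.1 <= n)%N by move=> cL; rewrite /n (big_rem c cL) leq_maxl.
  rewrite (_ : C L `&` bd = \big[setU/set0]_(y <- [seq y <- level n |
             all (fun c => anc c.1 y == c.2) L]) B y); last first.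
    rewrite -bigcup_seq; apply/seteqP; split => [r [rC rr]|r [y /=]].
      exists (r n); last by split=> //; rewrite (ray_dep Ht).
      rewrite /= mem_filter (ray_level Ht) // andbT; apply/allP => c cL.
      by rewrite (ray_anc Ht) ?Ln // rC.
    rewrite mem_filter (mem_level Ht) => /andP[/allP yL /eqP dy] [rr ry].
    split=> // c cL; rewrite -(eqP (yL _ cL)) -ry (ray_anc Ht) // dy; exact: Ln.
  have sm (m : {measure set (Ends V) -> \bar R}) s (P : pred V) : s = [seq y <- level n | P y] ->
      (m (\big[setU/set0]_(y <- s) B y) = \sum_(y <- s) m (B y))%E.
    move=> ->; rewrite -[LHS]mul1e -integral_cst; last by apply: bigsetU_measurable.
    rewrite ge0_integral_bigsetU //; last exact: bdry_sub_trivIset.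
      by apply: eq_bigr => y _; rewrite integral_cst // mul1e.
    exact/filter_uniq/(level_uniq Ht).
  by rewrite !(sm _ _ _ erefl); apply: eq_bigr.
- by [].
Qed.

End EndMeasure.

(** * Harmonic measures and the Poisson transform *)

Section HarmonicMeasure.
Context {V : pointedType} {o : V} {par : V -> V} {ch : V -> seq V} {dep : V -> nat}.
Context {R : realType} {p : V -> V -> R} {nu : V -> probability (Ends V) R}.
Hypothesis Ht : is_rooted_tree o par ch dep.
Hypothesis Hw : is_nn_random_walk o par ch p.
Hypothesis Htr : transient o par ch p.
Hypothesis HF : forall x, x != o -> hitF o par ch p x (par x) < 1.
Hypothesis Hnu : is_limit_distribution o par ch dep p nu.
Local Notation sub := (in_subtree par dep).
Local Notation level := (level o ch).
Local Notation bd := (bdry o ch).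
Local Notation B := (bdry_sub o ch dep).
Local Notation green := (green o par ch p).

Definition harm z y : R := fine (nu z (B y)).
Local Notation A := (harm o).
Local Notation F x := (green x o / green (par x) o).

Lemma harmE z y : nu z (B y) = (harm z y)%:E.
Proof. by rewrite /harm fineK // fin_num_measure //; exact: (measurable_bdry_sub Ht). Qed.

Lemma harm_ge0 z y : 0 <= harm z y.
Proof. by rewrite fine_ge0. Qed.

Lemma harm_root_gt0 y : 0 < A y.
Proof. by have := nu_root_gt0 Ht Hw Htr HF Hnu y; rewrite harmE lte_fin. Qed.

Lemma harm_root z : harm z o = 1.
Proof. by rewrite /harm (nu_bdry_sub_root Ht Hnu). Qed.

Lemma harm_ch z x : \sum_(y <- ch x) harm z y = harm z x.
Proof.
apply: EFin_inj; rewrite -harmE (measure_ch Ht) -sumEFin.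
by apply: eq_bigr => y _; rewrite -harmE.
Qed.

Lemma harm_level z n : \sum_(y <- level n) harm z y = 1.
Proof.
have o0 : (dep o <= n)%N by rewrite (dep_root Ht).
apply: EFin_inj; rewrite -(harm_root z) -harmE (measure_level Ht _ o0) -sumEFin.
 apply: eq_big => [y|y _]; first by rewrite (in_subtree_root Ht).
by rewrite -harmE.
Qed.

Lemma harm_green z y : y != o -> harm z y =
  (sub y z)%:R + (green z (par y) * p (par y) y - green z y * p y (par y)).
Proof. by move=> yo; rewrite /harm (nu_bdry_sub Ht Hw Htr Hnu). Qed.

(** Both ends of the edge above [y] lie outside [T_x], so [green_passage] applies to each Green
    function in [harm_green]. *)
Lemma harm_passage_disjoint x y : x != o -> ~~ sub x y -> ~~ sub y x ->
  harm x y = F x * harm (par x) y.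
Proof.
move=> xo xy yx; have yo : y != o.
  by apply: contra yx => /eqP ->; rewrite (in_subtree_root Ht).
have ypx : ~~ sub y (par x) by apply: contra yx => h; rewrite (in_subtree_par Ht) // h orbT.
have xpy : ~~ sub x (par y) by apply: contra xy => h; rewrite (in_subtree_par Ht) // h orbT.
rewrite !harm_green // (negbTE yx) (negbTE ypx) !add0r.
by rewrite (green_passage Ht Hw Htr xo xpy) (green_passage Ht Hw Htr xo xy); ring.
Qed.

(** As in the disjoint case, except that the starting indicator is 1 for both [x] and [par x]; this
    accounts for the constant [1 - F x]. *)
Lemma harm_passage_above x y : x != o -> sub y x -> y != x ->
  harm x y = F x * harm (par x) y + (1 - F x).
Proof.
move=> xo yx nyx; have [->|yo] := eqVneq y o; first by rewrite !harm_root; ring.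
have ypx : sub y (par x) by move: yx; rewrite (in_subtree_par Ht) // eq_sym (negbTE nyx).
have xy : ~~ sub x y by apply: contra nyx => xy; rewrite (in_subtree_anti Ht yx xy).
have xpy : ~~ sub x (par y) by apply: contra xy => h; rewrite (in_subtree_par Ht) // h orbT.
rewrite !harm_green // yx ypx /= (green_passage Ht Hw Htr xo xpy) (green_passage Ht Hw Htr xo xy).
ring.
Qed.

(** The edge above [x] ends inside [T_x], where [green_passage] does not apply. Total mass 1 is used
    instead: all other cells at the depth of [x] fall under the disjoint case. *)
Lemma harm_passage_self x : x != o -> harm x x = F x * harm (par x) x + (1 - F x).
Proof.
move=> xo; have lx : x \in level (dep x) by rewrite (mem_level Ht).
have split z : harm z x = 1 - \sum_(y <- level (dep x) | y != x) harm z y.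
  rewrite -(harm_level z (dep x)) (bigD1_seq x) ?(level_uniq Ht) //=; ring.
rewrite !split.
have -> : \sum_(y <- level (dep x) | y != x) harm x y =
          F x * \sum_(y <- level (dep x) | y != x) harm (par x) y; last by ring.
rewrite mulr_sumr big_seq_cond [RHS]big_seq_cond; apply: eq_bigr => y.
rewrite (mem_level Ht) => /andP[/eqP dy yx]; apply: harm_passage_disjoint => //.
  by apply: contra yx => s; rewrite (in_subtree_same_dep Ht s dy).
by apply: contra yx => s; rewrite (in_subtree_same_dep Ht s (esym dy)).
Qed.

(** Strictly below [z] the edge above [y] lies in [T_z], so [green_subtree] extracts one factor that
    depends on [z] alone. *)
Lemma harm_proportional z y : sub z y -> y != z -> harm z y = green z z / green o z * A y.
Proof.
move=> zy yz; have yo : y != o.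
  by apply: contra yz => /eqP e; move: zy; rewrite e (in_subtree_rootr Ht) eq_sym.
have zpy : sub z (par y) by move: zy; rewrite (in_subtree_par Ht) // (negbTE yz).
have yNz : ~~ sub y z by apply: contra yz => yz; rewrite (in_subtree_anti Ht yz zy).
rewrite !harm_green // (negbTE yNz) (in_subtree_rootr Ht) (negbTE yo) !add0r.
by rewrite (green_subtree Ht Hw Htr zy) (green_subtree Ht Hw Htr zpy); ring.
Qed.

(** On the cells below [x], [nu x] and [nu (par x)] are both multiples of [nu o]; the two constants
    are related by the case [y = x]. *)
Lemma harm_passage_below x y : x != o -> sub x y ->
  harm x y = F x * harm (par x) y + (1 - F x) / A x * A y.
Proof.
move=> xo xy; have Ax := harm_root_gt0 x.
have [->|yx] := eqVneq y x; first by rewrite divfK ?gt_eqF ?harm_passage_self.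
set C := green x x / green o x; set C' := green (par x) (par x) / green o (par x).
have px z : sub x z -> sub (par x) z.
  by apply: (in_subtree_trans Ht); rewrite (in_subtree_par Ht) // (in_subtree_refl Ht) orbT.
have npx z : sub x z -> z != par x.
  by apply: contraTneq => ->; rewrite (par_notin_subtree Ht).
(* [harm_proportional] excludes [y = x], hence the detour through the children of [x]. *)
have eC : harm x x = C * A x.
  rewrite -(harm_ch x x) -(harm_ch o x) mulr_sumr !big_seq; apply: eq_bigr => z zx.
  apply: harm_proportional; first by rewrite (in_subtree_ch Ht _ zx) (in_subtree_refl Ht) orbT.
  by apply: contraTneq zx => ->; apply/negP => /(dep_ch Ht) /eqP; rewrite ltn_eqF.
have eC' : harm (par x) x = C' * A x.
  by apply: harm_proportional; rewrite ?npx ?px ?(in_subtree_refl Ht).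
rewrite harm_proportional // (harm_proportional (px _ xy) (npx _ xy)) -/C -/C' mulrA -mulrDl.
congr (_ * _); have := harm_passage_self xo; rewrite eC eC' => e.
by apply: (mulIf (lt0r_neq0 Ax)); rewrite e mulrDl divfK ?gt_eqF // mulrA.
Qed.

Lemma passage_ratio x : x != o -> 0 <= F x <= 1.
Proof.
move=> xo; have g := green_root_gt0 Ht Hw Htr; rewrite divr_ge0 ?(ltW (g _)) //=.
by rewrite ler_pdivrMr // mul1r ltW // (green_par_lt Ht Hw Htr HF).
Qed.

Section Recursion.
Variables (x : V) (xo : x != o).

Let F_ge0 : 0 <= F x. Proof. by case/andP: (passage_ratio xo). Qed.
Let c_ge0 : 0 <= (1 - F x) / A x.
Proof. by rewrite divr_ge0 ?harm_ge0 // subr_ge0; case/andP: (passage_ratio xo). Qed.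
Let mBx : measurable (B x). Proof. exact: (measurable_bdry_sub Ht). Qed.
Let mixture : {measure set (Ends V) -> \bar R} :=
  measure_add (mscale (NngNum F_ge0) (nu (par x))) (mscale (NngNum c_ge0) (mrestr (nu o) mBx)).

Let mixtureE S : mixture S =
  ((F x)%:E * nu (par x) S + ((1 - F x) / A x)%:E * nu o (S `&` B x))%E.
Proof. exact: measure_addE. Qed.

(** Both sides are compared on cells, where the position of [y] relative to [x] selects one of the
    passage lemmas. *)
Lemma nu_mixture S : measurable S -> nu x S = mixture S.
Proof.
have mbd := measurable_bdry Ht.
have nuC z : nu z (~` bd) = 0%E.
  by rewrite probability_setC // (nu_bdry Hnu) subee.
apply: (ends_measure_unique Ht); first exact: nuC.
- rewrite mixtureE nuC mule0 add0e (_ : ~` bd `&` B x = set0) ?measure0 ?mule0 //.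
  by apply/seteqP; split => // r [nr [/nr]].
- by have : (nu x bd < +oo)%E by rewrite (nu_bdry Hnu) ltry.
move=> y; suff <- : (harm x y)%:E = mixture (B y) by rewrite -harmE.
rewrite mixtureE !harmE.
have [xy|xy] := boolP (sub x y).
  have -> : B y `&` B x = B y by apply/setIidPl/(bdry_sub_subset Ht).
  by rewrite harmE harm_passage_below // EFinD !EFinM.
have [yx|yx] := boolP (sub y x).
  have -> : B y `&` B x = B x by apply/setIidPr/(bdry_sub_subset Ht).
  rewrite harmE harm_passage_above // -?EFinM ?divfK ?gt_eqF ?harm_root_gt0 //.
  by apply: contraNneq xy => ->; rewrite (in_subtree_refl Ht).
rewrite (bdry_sub_disjoint Ht yx xy) measure0 mule0 adde0.
by rewrite harm_passage_disjoint // EFinM.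
Qed.

Lemma ge0_integral_mixture (g : Ends V -> \bar R) :
  measurable_fun bd g -> (forall r, bd r -> (0 <= g r)%E) ->
  (\int[nu x]_(r in bd) g r = (F x)%:E * \int[nu (par x)]_(r in bd) g r +
     ((1 - F x) / A x)%:E * \int[nu o]_(r in B x) g r)%E.
Proof.
move=> mg g0; have mbd := measurable_bdry Ht.
rewrite (eq_measure_integral mixture); last by move=> S mS _; exact: nu_mixture.
rewrite ge0_integral_measure_add // !ge0_integral_mscale //; congr (_ + _ * _)%E.
rewrite (@ge0_negligible_integral _ _ _ _ _ (~` B x)) //; last 2 first.
- exact: measurableC.
- by rewrite /= /mrestr setICl measure0.
rewrite setDE setCK setIidr; last exact: bdry_sub_bdry.
by apply: eq_measure_integral => S mS SB; rewrite /= /mrestr setIidl.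
Qed.

Lemma integrable_mixture (f : Ends V -> R) : (nu o).-integrable bd (EFin \o f) ->
  (nu (par x)).-integrable bd (EFin \o f) -> (nu x).-integrable bd (EFin \o f).
Proof.
move=> /integrableP[mf fo] /integrableP[_ fp]; apply/integrableP; split=> //.
have mbd := measurable_bdry Ht.
have maf : measurable_fun bd (fun r => `|(EFin \o f) r|)%E by exact: measurableT_comp.
rewrite ge0_integral_mixture //; apply: lte_add_pinfty; apply: lte_mul_pinfty => //.
apply: le_lt_trans fo; apply: ge0_subset_integral => //; exact: bdry_sub_bdry.
Qed.

(** The nonnegative formula is applied to positive and negative parts; integrability makes all
    integrals finite, so the difference can be rearranged in the reals. *)
Lemma integral_mixture (f : Ends V -> R) : (nu o).-integrable bd (EFin \o f) ->
  (nu (par x)).-integrable bd (EFin \o f) ->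
  fine (\int[nu x]_(r in bd) (f r)%:E) = F x * fine (\int[nu (par x)]_(r in bd) (f r)%:E) +
    (1 - F x) * (fine (\int[nu o]_(r in B x) (f r)%:E) / A x).
Proof.
move=> fo fp; have fx := integrable_mixture fo fp.
have mbd := measurable_bdry Ht.
have fB : (nu o).-integrable (B x) (EFin \o f).
  by apply: integrableS fo => //; exact: bdry_sub_bdry.
have mf : measurable_fun bd (EFin \o f) by case/integrableP: fo.
have parts (m : {measure set (Ends V) -> \bar R}) D : measurable D ->
    m.-integrable D (EFin \o f) -> fine (\int[m]_(r in D) (f r)%:E) =
      fine (\int[m]_(r in D) (EFin \o f)^\+%E r) - fine (\int[m]_(r in D) (EFin \o f)^\-%E r).
  move=> mD fD; rewrite integralE fineB //.
    exact: integrable_pos_fin_num.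
  exact: integrable_neg_fin_num.
rewrite !parts // !ge0_integral_mixture //; [|exact: measurable_funeneg|exact: measurable_funepos].
move: (integrable_pos_fin_num mbd fp) (integrable_neg_fin_num mbd fp).
move: (integrable_pos_fin_num mBx fB) (integrable_neg_fin_num mBx fB).
case: (integral (nu o) (B x) _) => [c| |] // _.
case: (integral (nu o) (B x) _) => [d| |] // _.
case: (integral (nu (par x)) bd _) => [a| |] // _.
case: (integral (nu (par x)) bd _) => [b| |] // _.
by rewrite /=; ring.
Qed.

End Recursion.

(** Integrability is assumed for [nu o] only. Carrying it to every [x] ensures that [poisson],
    defined through [fine], is a genuine integral. *)
Lemma integrable_nu (f : Ends V -> R) x : (nu o).-integrable bd (EFin \o f) ->
  (nu x).-integrable bd (EFin \o f).
Proof.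
move=> fo; move e : (dep x) => n; elim: n x e => [|n IH] x e.
  by move/eqP: e; rewrite (dep_eq0 Ht) => /eqP ->.
have xo : x != o by rewrite -(dep_eq0 Ht) e.
by apply: integrable_mixture => //; apply: IH; move: e; rewrite (dep_par Ht xo) => -[].
Qed.

Definition average (f : Ends V -> R) x := fine (\int[nu o]_(r in B x) (f r)%:E) / A x.

Lemma poisson_root (f : Ends V -> R) : poisson o ch nu f o = average f o.
Proof. by rewrite /poisson /average harm_root divr1 (bdry_sub_root Ht). Qed.

Lemma poisson_par (f : Ends V -> R) x : (nu o).-integrable bd (EFin \o f) -> x != o ->
  poisson o ch nu f x = F x * poisson o ch nu f (par x) + (1 - F x) * average f x.
Proof. by move=> fo xo; rewrite /poisson integral_mixture //; exact: integrable_nu. Qed.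

Lemma harm_average_ch (f : Ends V -> R) x : (nu o).-integrable bd (EFin \o f) ->
  \sum_(y <- ch x) A y * average f y = A x * average f x.
Proof.
move=> fo; have eA y : A y * average f y = fine (\int[nu o]_(r in B y) (f r)%:E).
  by rewrite /average mulrC divfK // gt_eqF // harm_root_gt0.
have fB y : (nu o).-integrable (B y) (EFin \o f).
  have mbd := measurable_bdry Ht.
  by apply: integrableS fo => //; [exact: (measurable_bdry_sub Ht)|exact: bdry_sub_bdry].
rewrite (eq_bigr _ (fun y _ => eA y)) eA (integral_level Ht _ (leqnSn (dep x))).
  rewrite (big_level_ch Ht) sum_fine // => y _.
  by apply: integrable_fin_num => //; exact: (measurable_bdry_sub Ht).
by case/integrableP: (fB x).
Qed.

Lemma cond_green x : x != o ->
  cond par dep p x * (green (par x) o - green x o) = A x.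
Proof. by move=> xo; rewrite /harm (nu_root_cond Ht Hw Htr Hnu). Qed.

Lemma poissonB (f g : Ends V -> R) x : (nu o).-integrable bd (EFin \o f) ->
  (nu o).-integrable bd (EFin \o g) ->
  poisson o ch nu (fun r => f r - g r) x = poisson o ch nu f x - poisson o ch nu g x.
Proof.
move=> fo go; rewrite /poisson.
have mbd := measurable_bdry Ht.
have fx := integrable_nu x fo; have gx := integrable_nu x go.
under eq_integral => r _ do rewrite EFinB.
by rewrite integralB_EFin // fineB // integrable_fin_num.
Qed.

Lemma poissonD (f g : Ends V -> R) x : (nu o).-integrable bd (EFin \o f) ->
  (nu o).-integrable bd (EFin \o g) ->
  poisson o ch nu (fun r => f r + g r) x = poisson o ch nu f x + poisson o ch nu g x.
Proof.
move=> fo go; rewrite /poisson.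
have mbd := measurable_bdry Ht.
have fx := integrable_nu x fo; have gx := integrable_nu x go.
under eq_integral => r _ do rewrite EFinD.
by rewrite (integralD_EFin mbd fx gx) fineD // integrable_fin_num.
Qed.

End HarmonicMeasure.

Arguments harm {V} o ch dep {R} nu.
Arguments average {V} o ch dep {R} nu f.

(** * Density of locally constant functions *)

Section Density.
Context {V : pointedType} {o : V} {par : V -> V} {ch : V -> seq V} {dep : V -> nat}.
Hypothesis Ht : is_rooted_tree o par ch dep.
Context {R : realType} (mu : probability (Ends V) R).
Local Notation anc := (anc par dep).
Local Notation bd := (bdry o ch).

Let mbd : measurable bd. Proof. exact: (measurable_bdry Ht). Qed.

Definition locally_constant (g : Ends V -> R) :=
  exists n (u : V -> R), forall r, bd r -> g r = u (r n).

Lemma locally_constant_measurable g : locally_constant g -> measurable_fun bd g.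
Proof.
move=> [n [u gu]]; apply: (eq_measurable_fun (fun r : Ends V => u (r n))).
  by move=> r; rewrite inE => /gu.
exact: (measurable_coord_fun Ht).
Qed.

Lemma locally_constant_op2 (op : R -> R -> R) g1 g2 :
  locally_constant g1 -> locally_constant g2 ->
  locally_constant (fun r => op (g1 r) (g2 r)).
Proof.
move=> [n1 [u1 g1u]] [n2 [u2 g2u]]; exists (maxn n1 n2).
exists (fun y => op (u1 (anc n1 y)) (u2 (anc n2 y))) => r rr.
by rewrite g1u // g2u // !(ray_anc Ht) ?leq_maxl ?leq_maxr.
Qed.

Definition l1_dist (f g : Ends V -> R) := (\int[mu]_(r in bd) `|f r - g r|%:E)%E.

Definition approximable (f : Ends V -> R) := forall e : R, 0 < e ->
  exists2 g, locally_constant g & (l1_dist f g < e%:E)%E.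

Lemma measurable_dist (f g : Ends V -> R) : measurable_fun bd f -> measurable_fun bd g ->
  measurable_fun bd (fun r => `|f r - g r|%:E).
Proof.
by move=> mf mg; apply/measurable_EFinP; apply: measurableT_comp => //; exact: measurable_funB.
Qed.

Lemma l1_dist_op2 (op : R -> R -> R) (f1 f2 g1 g2 : Ends V -> R) :
  (forall a b c d, `|op a b - op c d| <= `|a - c| + `|b - d|) ->
  measurable_fun bd f1 -> measurable_fun bd f2 ->
  measurable_fun bd (fun r => op (f1 r) (f2 r)) ->
  measurable_fun bd g1 -> measurable_fun bd g2 ->
  measurable_fun bd (fun r => op (g1 r) (g2 r)) ->
  (l1_dist (fun r => op (f1 r) (f2 r)) (fun r => op (g1 r) (g2 r)) <=
   l1_dist f1 g1 + l1_dist f2 g2)%E.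
Proof.
move=> opL mf1 mf2 mf mg1 mg2 mg.
rewrite /l1_dist -ge0_integralD //; [|exact: measurable_dist|exact: measurable_dist].
apply: ge0_le_integral => //; first exact: measurable_dist.
  by apply: emeasurable_funD; exact: measurable_dist.
by move=> r _; rewrite -EFinD lee_fin.
Qed.

(** Stated for any operation that is 1-Lipschitz in the sum of the coordinate distances, so that
    addition and maximum share one proof. *)
Lemma approximable_op2 (op : R -> R -> R) (f1 f2 : Ends V -> R) :
  (forall a b c d, `|op a b - op c d| <= `|a - c| + `|b - d|) ->
  measurable_fun bd f1 -> measurable_fun bd f2 ->
  measurable_fun bd (fun r => op (f1 r) (f2 r)) ->
  approximable f1 -> approximable f2 -> approximable (fun r => op (f1 r) (f2 r)).
Proof.
move=> opL mf1 mf2 mf a1 a2 e e0; have e2 : 0 < e / 2 by rewrite divr_gt0.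
have [g1 l1 d1] := a1 _ e2; have [g2 l2 d2] := a2 _ e2.
exists (fun r => op (g1 r) (g2 r)); first exact: locally_constant_op2.
have le := l1_dist_op2 opL mf1 mf2 mf (locally_constant_measurable l1)
  (locally_constant_measurable l2) (locally_constant_measurable (locally_constant_op2 op l1 l2)).
apply: (le_lt_trans le); rewrite (splitr e) EFinD; exact: lteD.
Qed.

Lemma approximableD (f1 f2 : Ends V -> R) : measurable_fun bd f1 -> measurable_fun bd f2 ->
  approximable f1 -> approximable f2 -> approximable (fun r => f1 r + f2 r).
Proof.
move=> mf1 mf2; apply: approximable_op2 => //; last exact: measurable_funD.
by move=> a b c d; rewrite opprD addrACA ler_normD.
Qed.

Lemma approximable_max (f1 f2 : Ends V -> R) : measurable_fun bd f1 -> measurable_fun bd f2 ->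
  approximable f1 -> approximable f2 -> approximable (fun r => Num.max (f1 r) (f2 r)).
Proof.
move=> mf1 mf2; apply: approximable_op2 => //; last exact: measurable_maxr.
move=> a b c d; have := ler_norm (a - c); have := ler_norm (c - a).
have := ler_norm (b - d); have := ler_norm (d - b).
rewrite (distrC c a) (distrC d b) ler_norml.
by case: (leP a b) => ?; case: (leP c d) => ?; move=> *; apply/andP; split; lra.
Qed.

Lemma approximableZ a (f : Ends V -> R) : measurable_fun bd f ->
  approximable f -> approximable (fun r => a * f r).
Proof.
move=> mf af e e0; have a1 : 0 < `|a| + 1 by rewrite ltr_wpDl.
have [g lg d] := af _ (divr_gt0 e0 a1).
exists (fun r => a * g r); first exact: (locally_constant_op2 (fun x _ => a * x) lg lg).
have mg := locally_constant_measurable lg.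
rewrite /l1_dist; under eq_integral => r _ do rewrite -mulrBr normrM EFinM.
rewrite ge0_integralZl_EFin //; last exact: measurable_dist.
apply: (@le_lt_trans _ _ ((`|a| + 1)%:E * l1_dist f g)%E).
  rewrite lee_wpmul2r ?lee_fin ?lerDl //; apply: integral_ge0 => r _.
  by rewrite lee_fin.
by rewrite -lte_pdivlMl // -EFinM mulrC.
Qed.

Lemma approximable_lim (f : Ends V -> R) : measurable_fun bd f ->
  (forall e : R, 0 < e -> exists f', [/\ measurable_fun bd f', approximable f' &
     (l1_dist f f' < e%:E)%E]) -> approximable f.
Proof.
move=> mf H e e0; have e2 : 0 < e / 2 by rewrite divr_gt0.
have [f' [mf' af' d']] := H _ e2; have [g lg d] := af' _ e2; exists g => //.
have mg := locally_constant_measurable lg.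
apply: (@le_lt_trans _ _ (l1_dist f f' + l1_dist f' g)%E); last first.
  by rewrite (splitr e) EFinD; exact: lteD.
rewrite /l1_dist -ge0_integralD //; [|exact: measurable_dist|exact: measurable_dist].
apply: ge0_le_integral => //; first exact: measurable_dist.
  by apply: emeasurable_funD; exact: measurable_dist.
by move=> r _; rewrite -EFinD lee_fin (le_trans _ (ler_normD _ _)) // subrKA.
Qed.

Lemma locally_constant_approximable f : locally_constant f -> approximable f.
Proof.
move=> lf e e0; exists f => //; rewrite /l1_dist.
under eq_integral => r _ do rewrite subrr normr0.
by rewrite integral0 lte_fin.
Qed.

(** The sets with this property form a sigma-algebra containing the coordinate sets: complements
    come from [1 - \1_S], finite unions from maxima, countable unions from continuity of the finite
    measure [mu]. *)
Lemma approximable_indic S : measurable S -> approximable \1_S.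
Proof.
pose C := [set S : set (Ends V) | measurable S /\ approximable \1_S].
suff sC : sigma_algebra setT C.
  have H : measurable `<=` C.
    apply: smallest_sub => // _ [n [v ->]]; split; first exact: measurable_coord.
    apply: locally_constant_approximable; exists n, (fun y => (y == v)%:R) => r _.
    rewrite indicE; congr (_%:R); congr (nat_of_bool _).
    by apply/idP/eqP; rewrite inE.
  by move=> mS; case: (H S mS).
have C0 : C set0.
  split=> //; apply: locally_constant_approximable.
  by exists 0%N, (fun=> 0) => r _; rewrite indicE in_set0.
have CU S1 S2 : C S1 -> C S2 -> C (S1 `|` S2).
  move=> [mS1 a1] [mS2 a2]; split; first exact: measurableU.
  rewrite (_ : \1__ = fun r => Num.max (\1_S1 r) (\1_S2 r) : R).
    by apply: approximable_max => //; exact: measurable_indic.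
  apply/funext => r; rewrite !indicE in_setU.
  case: (r \in S1); case: (r \in S2); rewrite /= ?mulr1n ?mulr0n ?maxxx //.
    by rewrite max_l ?ler01.
  by rewrite max_r ?ler01.
split => //.
- move=> S0 [mS0 aS0]; rewrite setTD; split; first exact: measurableC.
  rewrite (_ : \1__ = fun r => (fun=> 1) r + (-1) * \1_S0 r : R); last first.
    apply/funext => r; rewrite !indicE in_setC.
    by case: (r \in S0); rewrite ?mulr1 ?subrr ?mulr0 ?addr0.
  have mi : measurable_fun bd (\1_S0 : Ends V -> R) by exact: measurable_indic.
  apply: approximableD => //.
  + exact: measurable_funM.
  + by apply: locally_constant_approximable; exists 0%N, (fun=> 1).
  + exact: approximableZ.
- move=> F CF.
  have mF k : measurable (F k) by case: (CF k).
  have CFn n : C (\big[setU/set0]_(k < n) F k).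
    by elim: n => [|n IH]; rewrite ?big_ord0 // big_ord_recr /=; exact: CU.
  have mU : measurable (\bigcup_k F k) by exact: bigcup_measurable.
  split=> //; apply: approximable_lim => [|e e0]; first exact: measurable_indic.
  (* What the first [n] sets leave uncovered; these remainders decrease to the empty set. *)
  set Gn := fun n => \bigcup_k F k `\` \big[setU/set0]_(k < n) F k.
  have mG n : measurable (Gn n) by apply: measurableD => //; case: (CFn n).
  have G0 : \bigcap_n Gn n = set0.
    apply/seteqP; split => // r H; have [[k _ Fk] _] := H 0%N I.
    have [_] := H k.+1 I; apply; rewrite -bigcup_mkord; by exists k => /=.
  have : (mu \o Gn) n @[n --> \oo] --> (0 : \bar R)%E.
    rewrite -[X in _ --> X](measure0 mu) -G0; apply: nonincreasing_cvg_mu => //.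
    + by rewrite -ge0_fin_numE // fin_num_measure.
    + by rewrite G0.
    + move=> m n mn; apply/subsetPset => r [Ur nr]; split=> // Fm; apply: nr.
      by move: Fm; apply: subset_bigsetU.
  move/fine_cvgP => [fG /cvgr0Pnorm_lt /(_ _ e0) small].
  have [n Gne] : exists n, (mu (Gn n) < e%:E)%E.
    near \oo => n; exists n.
    have fn : mu (Gn n) \is a fin_num by rewrite fin_num_measure.
    rewrite -(fineK fn) lte_fin; apply: le_lt_trans (ler_norm _) _.
    by near: n.
  exists \1_(\big[setU/set0]_(k < n) F k); have [mn an] := CFn n; split=> //.
  rewrite /l1_dist; under eq_integral => r _.
    rewrite (_ : `|_| = \1_(Gn n) r); last first.
      rewrite !indicE in_setD.
      have [rn|rn] := boolP (r \in \big[setU/set0]_(k < n) F k).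
        have -> : r \in \bigcup_k F k by move: rn; rewrite !inE; exact: bigsetU_bigcup.
        by rewrite subrr normr0.
      by rewrite subr0 normr_nat; case: (r \in _).
    over.
  rewrite integral_indic //; apply: le_lt_trans Gne; apply: le_measure; rewrite ?inE //.
  exact: measurableI.
Unshelve. all: by end_near. Qed.

Lemma approximable_integrable (f : Ends V -> R) : mu.-integrable bd (EFin \o f) -> approximable f.
Proof.
move=> fi; have mf : measurable_fun bd f by apply/measurable_EFinP; case/integrableP: fi.
apply: approximable_lim => // e e0.
have [g_ [_ _ /fine_cvgP[fing /cvgr0Pnorm_lt/(_ _ e0) small]]] :=
  approximation_sfun_integrable mbd fi.
have [n [fn gn]] : exists n, (\int[mu]_(z in bd) `|(EFin \o f) z - (g_ n z)%:E|)%E \is a fin_num /\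
   (\int[mu]_(z in bd) `|(EFin \o f) z - (g_ n z)%:E| < e%:E)%E.
  near \oo => n; exists n.
  have fn : (\int[mu]_(z in bd) `|(EFin \o f) z - (g_ n z)%:E|)%E \is a fin_num by near: n.
  split=> //; rewrite -(fineK fn) lte_fin; apply: le_lt_trans (ler_norm _) _.
  by near: n.
have mg : measurable_fun bd (g_ n) by exact: measurable_funTS.
exists (g_ n); split => //.
rewrite (_ : (g_ n : Ends V -> R) = fun r => \sum_(y <- finmap.enum_fset (fset_set (range (g_ n))))
     y * \1_(g_ n @^-1` [set y]) r); last first.
  by apply/funext => r; rewrite fimfunE fsbig_finite.
have mi y : measurable_fun bd (\1_(g_ n @^-1` [set y]) : Ends V -> R).
  by apply: measurable_indic; exact: measurable_sfunP.
elim: (finmap.enum_fset _) => [|y s IHs].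
  apply: locally_constant_approximable; exists 0%N, (fun=> 0) => r _.
  by rewrite big_nil.
rewrite (_ : (fun r => _) = fun r => y * \1_(g_ n @^-1` [set y]) r +
   \sum_(y <- s) y * \1_(g_ n @^-1` [set y]) r); last first.
  by apply/funext => r; rewrite big_cons.
apply: approximableD => //.
- exact: measurable_funM.
- by apply: measurable_sum => z; exact: measurable_funM.
- apply: approximableZ => //; apply: approximable_indic; exact: measurable_sfunP.
Unshelve. all: by end_near. Qed.

End Density.

(** * Square integrals as limits of level sums *)

Section SquareIntegral.
Context {V : pointedType} {o : V} {par : V -> V} {ch : V -> seq V} {dep : V -> nat}.
Hypothesis Ht : is_rooted_tree o par ch dep.
Context {R : realType} (nu : V -> probability (Ends V) R).
Local Notation sub := (in_subtree par dep).
Local Notation anc := (anc par dep).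
Local Notation level := (level o ch).
Local Notation bd := (bdry o ch).
Local Notation B := (bdry_sub o ch dep).
Local Notation mu := (nu o).
Local Notation A := (harm o ch dep nu o).
Hypothesis A_gt0 : forall x, 0 < A x.

Let mbd : measurable bd. Proof. exact: (measurable_bdry Ht). Qed.
Let mB x : measurable (B x). Proof. exact: (measurable_bdry_sub Ht). Qed.

Let integral_cell_cst x (v : R) : (\int[mu]_(r in B x) v%:E = (A x * v)%:E)%E.
Proof.
rewrite -[LHS]/(integral mu (B x) (cst v%:E)) integral_cst //.
by rewrite -[X in (_ * X)%E]/(nu o (B x)) (harmE Ht) -EFinM mulrC.
Qed.

Section Function.
Variable f : Ends V -> R.
Hypothesis fi : mu.-integrable bd (EFin \o f).
Local Notation X := (average o ch dep nu f).

Let fB x : mu.-integrable (B x) (EFin \o f).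
Proof. by apply: integrableS fi => //; exact: bdry_sub_bdry. Qed.

Let mf : measurable_fun bd f.
Proof. by apply/measurable_EFinP; case/integrableP: fi. Qed.

Let mfB x : measurable_fun (B x) f.
Proof. by apply: measurable_funS mf => //; exact: bdry_sub_bdry. Qed.

Lemma integral_average x : (\int[mu]_(r in B x) (f r)%:E = (A x * X x)%:E)%E.
Proof. by rewrite /average mulrC divfK ?gt_eqF // fineK // integrable_fin_num. Qed.

Lemma average_dist x (v : R) :
  ((A x * `|X x - v|)%:E <= \int[mu]_(r in B x) `|f r - v|%:E)%E.
Proof.
have vi : mu.-integrable (B x) (EFin \o cst v).
  by apply: finite_measure_integrable_cst.
have -> : (A x * `|X x - v|)%:E = (`| \int[mu]_(r in B x) (f r - v)%:E |)%E.
  under eq_integral => r _ do rewrite EFinB.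
  rewrite (integralB_EFin (mB x) (fB x) vi) integral_average integral_cell_cst.
  by rewrite -EFinB abse_EFin -{1}(gtr0_norm (A_gt0 x)) -normrM; congr (`|_|%:E); ring.
apply: le_abse_integral => //; apply/measurable_EFinP; exact: measurable_funB.
Qed.

(** Truncation to [[-K, K]]: its square is [2K]-Lipschitz, so L^1-closeness suffices to compare
    squares before [f] is known to be in L^2. *)
Let clip (K t : R) := Num.max (- K) (Num.min K t).

Let clip_range K t : 0 <= K -> - K <= clip K t <= K.
Proof. by move=> K0; rewrite /clip le_max lexx ge_max ge_min lexx /= andbT; lra. Qed.

Let max_dist (c s t : R) : `|Num.max c s - Num.max c t| <= `|s - t|.
Proof.
have := ler_norm (s - t); have := ler_norm (t - s); rewrite (distrC t s) ler_norml.
by case: (leP c s) => ?; case: (leP c t) => ?; move=> *; apply/andP; split; lra.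
Qed.

Let min_dist (c s t : R) : `|Num.min c s - Num.min c t| <= `|s - t|.
Proof.
have := ler_norm (s - t); have := ler_norm (t - s); rewrite (distrC t s) ler_norml.
by case: (leP c s) => ?; case: (leP c t) => ?; move=> *; apply/andP; split; lra.
Qed.

Let clip_sq K a b : 0 <= K -> clip K a ^+ 2 <= clip K b ^+ 2 + K *+ 2 * `|a - b|.
Proof.
move=> K0; have ra := clip_range a K0; have rb := clip_range b K0.
have l : `|clip K a - clip K b| <= `|a - b| := le_trans (max_dist _ _ _) (min_dist _ _ _).
rewrite -lerBlDl subr_sqr; apply: le_trans (ler_norm _) _; rewrite normrM mulrC.
move/andP: ra => [? ?]; move/andP: rb => [? ?].
by apply: ler_pM => //; rewrite ler_norml mulr2n; apply/andP; split; lra.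
Qed.

Let clip_le K t : 0 <= K -> clip K t ^+ 2 <= t ^+ 2.
Proof.
move=> K0; rewrite -(real_normK (num_real (clip K t))) -(real_normK (num_real t)).
have c0 : clip K 0 = 0 by rewrite /clip min_r ?max_r ?oppr_le0.
have l : `|clip K t - clip K 0| <= `|t - 0| := le_trans (max_dist _ _ _) (min_dist _ _ _).
by rewrite c0 !subr0 in l; rewrite lerXn2r ?nnegrE.
Qed.

Let clip_clip a b t : 0 <= a -> a <= b -> clip a (clip b t) = clip a t.
Proof.
move=> a0 ab; rewrite /clip; have [bt|tb] := leP b t.
  by rewrite [Num.max (- b) _]max_r; [rewrite !min_l //; lra|lra].
have [bt|tb'] := leP (- b) t; first by [].
by rewrite !min_r ?max_l //; lra.
Qed.

Let measurable_clip K D : measurable_fun D f -> measurable_fun D (fun r => clip K (f r) ^+ 2).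
Proof.
move=> m; apply: measurable_funX; apply: measurable_maxr => //.
exact: measurable_minr.
Qed.

(** Going from [f] to the constant [v], and from [v] to the average, each costs [2K] times the
    L^1-distance to [v]; hence the factor 4. *)
Let clip_cell K y v : 0 <= K ->
  (\int[mu]_(r in B y) (clip K (f r) ^+ 2)%:E <=
   (A y * X y ^+ 2)%:E + (K *+ 4)%:E * \int[mu]_(r in B y) `|f r - v|%:E)%E.
Proof.
move=> K0; have K2 : 0 <= K *+ 2 by rewrite mulrn_wge0.
have md : measurable_fun (B y) (fun r => `|f r - v|%:E).
  by apply/measurable_EFinP; apply: measurableT_comp => //; exact: measurable_funB.
set I := (\int[mu]_(r in B y) `|f r - v|%:E)%E.
have I0 : (0 <= I)%E by apply: integral_ge0 => r _; rewrite lee_fin.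
apply: (@le_trans _ _ ((A y * clip K v ^+ 2)%:E + (K *+ 2)%:E * I)%E).
  rewrite -integral_cell_cst -ge0_integralZl_EFin //.
  rewrite -ge0_integralD //; last first.
  - exact: measurable_funeM.
  - by move=> r _; rewrite mule_ge0 ?lee_fin.
  - by move=> r _; rewrite lee_fin sqr_ge0.
  apply: ge0_le_integral => //.
  - by move=> r _; rewrite lee_fin sqr_ge0.
  - by apply/measurable_EFinP; exact: measurable_clip.
  - by apply: emeasurable_funD => //; exact: measurable_funeM.
  - by move=> r _; rewrite -EFinM -EFinD lee_fin clip_sq.
have -> : ((K *+ 4)%:E * I = (K *+ 2)%:E * I + (K *+ 2)%:E * I)%E.
  by rewrite -ge0_muleDl ?lee_fin // -EFinD -mulrnDr.
rewrite [leRHS]addeA; apply: leeD2r.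
apply: (@le_trans _ _ ((A y * X y ^+ 2)%:E + (K *+ 2)%:E * (A y * `|X y - v|)%:E)%E).
  rewrite -EFinM -EFinD lee_fin [K *+ 2 * _]mulrCA -mulrDr ler_wpM2l ?(ltW (A_gt0 y)) //.
  rewrite (le_trans (clip_sq v (X y) K0)) // distrC lerD2r; exact: clip_le.
by apply: leeD2l; apply: lee_wpmul2l; rewrite ?lee_fin // average_dist.
Qed.

(** A locally constant L^1-approximation supplies the constants [v] of [clip_cell] on all cells of a
    deep level at once. *)
Let clip_bound K x c : 0 <= K ->
  (forall N, (dep x <= N)%N -> level_square o par ch dep A X x N <= c) ->
  (\int[mu]_(r in B x) (clip K (f r) ^+ 2)%:E <= c%:E)%E.
Proof.
move=> K0 Xc; apply/lee_addgt0Pr => e e0.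
have K4 : 0 < K *+ 4 + 1 by rewrite ltr_wpDl // mulrn_wge0.
have [g [n [u gu]] fg] := approximable_integrable Ht fi (divr_gt0 e0 K4).
(* Deep enough for [g] to be constant on every cell and for the cell of [x] to split into cells of
   this level. *)
pose N := maxn n (dep x); have xN : (dep x <= N)%N by rewrite leq_maxr.
have mg : measurable_fun bd g by apply: (locally_constant_measurable Ht); exists n, u.
have mdx : measurable_fun (B x) (fun r => `|f r - g r|%:E).
  by apply: measurable_funS (measurable_dist mf mg) => //; exact: bdry_sub_bdry.
rewrite (ge0_integral_level Ht _ xN); last first.
- by move=> r _; rewrite lee_fin sqr_ge0.
- by apply/measurable_EFinP; exact: measurable_clip.
have cell y : y \in level N -> (\int[mu]_(r in B y) (clip K (f r) ^+ 2)%:E <=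
    (A y * X y ^+ 2)%:E + (K *+ 4)%:E * \int[mu]_(r in B y) `|f r - g r|%:E)%E.
  rewrite (mem_level Ht) => /eqP dy.
  rewrite [X in (_ <= _ + _ * X)%E](_ : _ = \int[mu]_(r in B y) `|f r - u (anc n y)|%:E)%E.
    exact: clip_cell.
  apply: eq_integral => r; rewrite inE => -[rr ry]; rewrite gu // -ry (ray_anc Ht) //.
  by rewrite dy leq_maxl.
apply: (@le_trans _ _ (\sum_(y <- level N | sub x y) ((A y * X y ^+ 2)%:E +
    (K *+ 4)%:E * \int[mu]_(r in B y) `|f r - g r|%:E))%E).
  by rewrite big_seq_cond [leRHS]big_seq_cond; apply: lee_sum => y /andP[/cell].
rewrite big_split /= sumEFin leeD ?lee_fin ?Xc //.
rewrite -ge0_sume_distrr; last by move=> y _; apply: integral_ge0 => r _; rewrite lee_fin.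
rewrite -(ge0_integral_level Ht _ xN) //.
apply: (@le_trans _ _ ((K *+ 4 + 1)%:E * (e / (K *+ 4 + 1))%:E)%E).
  apply: lee_pmul; rewrite ?lee_fin ?mulrn_wge0 ?lerDl //.
    by apply: integral_ge0 => r _; rewrite lee_fin.
  apply: (le_trans _ (ltW fg)); apply: ge0_subset_integral => //.
    exact: measurable_dist.
  exact: bdry_sub_bdry.
by rewrite -EFinM mulrC divfK // gt_eqF.
Qed.

(** The truncated bounds do not depend on the height, so monotone convergence removes the
    truncation. *)
Lemma square_integral_le x c :
  (forall N, (dep x <= N)%N -> level_square o par ch dep A X x N <= c) ->
  (\int[mu]_(r in B x) (f r ^+ 2)%:E <= c%:E)%E.
Proof.
move=> Xc; pose g (k : nat) r := (clip k%:R (f r) ^+ 2)%:E.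
have gE k r : `|f r| <= k%:R -> g k r = (f r ^+ 2)%:E.
  rewrite ler_norml => /andP[h1 h2]; rewrite /g /clip min_r // max_r //.
have lg r : limn (g^~ r) = (f r ^+ 2)%:E.
  apply: cvg_lim => //; apply: cvg_near_cst; near=> k; apply: gE.
  by near: k; exact: nbhs_infty_ger.
have ndg r : {homo g^~ r : m n / (m <= n)%N >-> (m <= n)%E}.
  move=> m n mn; rewrite /g lee_fin.
  (* Clipping at [m] factors through clipping at [n], so monotonicity in the height is an instance
     of [clip_le]. *)
  rewrite -(@clip_clip m%:R n%:R) ?ler0n ?ler_nat //.
  by apply: clip_le; rewrite ler0n.
under eq_integral => r _ do rewrite -lg.
have mg k : measurable_fun (B x) (g k) by apply/measurable_EFinP; exact: measurable_clip.
have g0 k r : B x r -> (0 <= g k r)%E by rewrite lee_fin sqr_ge0.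
have cg := @cvg_monotone_convergence _ _ _ mu _ (mB x) _ mg g0 (fun r _ => ndg r).
rewrite -(cvg_lim _ cg) //; apply: lime_le; first by apply/cvg_ex; eexists; exact: cg.
by near=> k; apply: clip_bound.
Unshelve. all: by end_near. Qed.

Hypothesis f2 : (\int[mu]_(r in bd) (f r ^+ 2)%:E < +oo)%E.

Lemma square_integrable x : mu.-integrable (B x) (fun r => (f r ^+ 2)%:E).
Proof.
apply: (@integrableS _ _ _ _ bd) => //; first exact: bdry_sub_bdry.
apply/integrableP; split; first by apply/measurable_EFinP; exact: measurable_funX.
by under eq_integral => r _ do rewrite gee0_abs ?lee_fin ?sqr_ge0 //.
Qed.

Let Q y := fine (\int[mu]_(r in B y) (f r ^+ 2)%:E).

Let QE y : (\int[mu]_(r in B y) (f r ^+ 2)%:E = (Q y)%:E)%E.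
Proof. by rewrite fineK // (integrable_fin_num (mB y) (square_integrable y)). Qed.

Lemma integral_quadratic y (a b c : R) :
  (\int[mu]_(r in B y) (a * f r ^+ 2 + b * f r + c)%:E =
   (a * Q y + b * (A y * X y) + A y * c)%R%:E)%E.
Proof.
have i2 := integrableZl (mB y) a (square_integrable y).
have i1 := integrableZl (mB y) b (fB y).
have i0 : mu.-integrable (B y) (EFin \o cst c) by apply: finite_measure_integrable_cst.
under eq_integral => r _ do rewrite !EFinD.
rewrite (integralD (mB y) (integrableD (mB y) i2 i1) i0) integral_cell_cst.
rewrite (integralD (mB y) i2 i1) (integralZl (mB y) (square_integrable y)).
by rewrite (integralZl (mB y) (fB y)) QE integral_average -!EFinM -!EFinD.
Qed.

Lemma integral_square_dist y (c : R) : (\int[mu]_(r in B y) ((c - f r) ^+ 2)%:E =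
   (Q y - c *+ 2 * (A y * X y) + A y * c ^+ 2)%R%:E)%E.
Proof.
under eq_integral => r _.
  rewrite (_ : (c - f r) ^+ 2 = 1 * f r ^+ 2 + - (c *+ 2) * f r + c ^+ 2); last by ring.
  over.
by rewrite integral_quadratic; congr (_%:E); ring.
Qed.

(** Jensen's inequality, read off from the nonnegativity of the variance on the cell. *)
Lemma square_average_le y : ((A y * X y ^+ 2)%:E <= \int[mu]_(r in B y) (f r ^+ 2)%:E)%E.
Proof.
have : (0 <= \int[mu]_(r in B y) ((X y - f r) ^+ 2)%:E)%E.
  by apply: integral_ge0 => r _; rewrite lee_fin sqr_ge0.
rewrite integral_square_dist QE !lee_fin => h; rewrite -subr_ge0; apply: le_trans h _.
by rewrite le_eqVlt; apply/orP; left; apply/eqP; ring.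
Qed.

Hypothesis AX_ch : forall x, \sum_(y <- ch x) A y * X y = A x * X x.

Lemma level_square_cvg x : level_square o par ch dep A X x @ \oo -->
  fine (\int[mu]_(r in B x) (f r ^+ 2)%:E).
Proof.
have A_ge0 y : 0 <= A y by exact: ltW.
have A_ch y : \sum_(z <- ch y) A z = A y by exact: (harm_ch Ht).
set q := level_square o par ch dep A X x; rewrite -/(Q x).
have qQ N : (dep x <= N)%N -> q N <= Q x.
  move=> xN; rewrite -lee_fin -QE (ge0_integral_level Ht _ xN); last first.
  - by move=> r _; rewrite lee_fin sqr_ge0.
  - by apply/measurable_EFinP; apply: measurable_funX.
  by rewrite /q /level_square -sumEFin; apply: lee_sum => y _; exact: square_average_le.
(* Monotonicity of the level sums is available only from the depth of [x] on. *)
pose q' n := q (n + dep x)%N.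
have ndq' : nondecreasing_seq q'.
  by move=> m n mn; apply: (level_square_le Ht) => //; rewrite leq_addl leq_add2r.
have cq' : cvgn q'.
  apply: nondecreasing_is_cvgn => //; exists (Q x) => _ [n _ <-].
  by apply: qQ; rewrite leq_addl.
suff qE : limn q' = Q x.
  have c : q' @ \oo --> Q x by rewrite -qE; exact: cq'.
  by move: c; rewrite /q' cvg_shiftn.
apply/eqP; rewrite eq_le; apply/andP; split.
  by apply: limr_le => //; near=> n; apply: qQ; rewrite leq_addl.
rewrite -lee_fin -QE; apply: square_integral_le => N xN.
by rewrite -(subnK xN); exact: (nondecreasing_cvgn_le ndq' cq').
Unshelve. all: by end_near. Qed.

End Function.
End SquareIntegral.

(** * The jump kernel *)

Section JumpKernel.
Context {V : pointedType} {o : V} {par : V -> V} {ch : V -> seq V} {dep : V -> nat}.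
Hypothesis Ht : is_rooted_tree o par ch dep.
Context {R : realType} (nu : V -> probability (Ends V) R) (phi : V -> R).
Hypothesis phi_gt0 : forall x, 0 < phi x.
Hypothesis phi_par : forall x, x != o -> phi x < phi (par x).
Local Notation bd := (bdry o ch).
Local Notation B := (bdry_sub o ch dep).
Local Notation mu := (nu o).
Local Notation first_diff := Defs.first_diff.
Local Notation A := (harm o ch dep nu o).
Hypothesis A_gt0 : forall x, 0 < A x.
Hypothesis A_root : A o = 1.

Lemma first_diffP (r s : nat -> V) : r <> s ->
  r (first_diff r s) != s (first_diff r s) /\ forall k, (k < first_diff r s)%N -> r k = s k.
Proof.
move=> rs; rewrite /Defs.first_diff; case: (pselect (exists n, r n != s n)) => [H|H]; last first.
  exfalso; apply: rs; apply: funext => n; apply/eqP/negPn/negP => nrs.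
  by apply: H; exists n.
case: (ex_minnP H) => n rn min; split=> // k kn; apply/eqP/negPn/negP => /min.
by rewrite leqNgt kn.
Qed.

(** Each vertex determines its ancestors, so rays from [o] that have separated never meet again. *)
Lemma ray_eq_first_diff r s k : bd r -> bd s -> r <> s -> (r k == s k) = (k < first_diff r s)%N.
Proof.
move=> rr ss rs; have [d e] := first_diffP rs; apply/idP/idP => [/eqP rk|/e ->//].
rewrite ltnNge; apply: contra d => dk.
by rewrite -(ray_anc Ht rr dk) -(ray_anc Ht ss dk) rk.
Qed.

Lemma first_diff_gt0 r s : bd r -> bd s -> r <> s -> (0 < first_diff r s)%N.
Proof.
by move=> rr ss rs; rewrite -ray_eq_first_diff // (proj1 rr) (proj1 ss).
Qed.

Lemma phi_ray_lt r n : bd r -> phi (r n.+1) < phi (r n).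
Proof.
move=> rr; rewrite -[r n](ray_par Ht n rr); apply: phi_par.
by rewrite -(dep_eq0 Ht) (ray_dep Ht rr).
Qed.

Lemma phi_ray_le r m n : bd r -> (m <= n)%N -> phi (r n) <= phi (r m).
Proof.
move=> rr /subnK <-; elim: (n - m)%N => [//|k IH].
by rewrite addSn; apply: (le_trans _ IH); exact: (ltW (phi_ray_lt _ rr)).
Qed.

Lemma uball_ray r n rad : bd r -> phi (r n.+1) <= rad -> rad < phi (r n) ->
  uball o ch phi r rad = B (r n.+1).
Proof.
move=> rr lo hi; apply/seteqP; split => s [ss].
  rewrite /udist; case: (pselect _) => [rs _|rs]; first by split=> //; rewrite -rs (ray_dep Ht).
  rewrite /confl => d; split=> //; rewrite (ray_dep Ht) //; apply/esym/eqP.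
  rewrite ray_eq_first_diff // ltnNge; apply/negP => dn.
  have := le_lt_trans d hi; rewrite ltNge => /negP; apply; apply: phi_ray_le => //.
  by move: dn; case: (first_diff r s).
rewrite (ray_dep Ht) // => e; split=> //; rewrite /udist; case: (pselect _) => [rs|rs] /=.
  exact: le_trans (ltW (phi_gt0 _)) lo.
have : r n.+1 == s n.+1 by rewrite e.
rewrite ray_eq_first_diff // => nd; apply: le_trans lo; apply: phi_ray_le => //.
by move: nd; case: (first_diff r s).
Qed.

Let integrand r (t : R) := (fine (mu (uball o ch phi r t^-1)))^-1.

(** Between consecutive values of [1 / phi] along the ray the ball is a fixed cell, and the interval
    length is [rate]. The intervals are closed on the right because the balls are closed.
    Measurability travels with the induction since additivity of the integral needs it. *)
Lemma jump_integral r n : bd r ->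
  measurable_fun (`[(phi o)^-1, (phi (r n))^-1]%classic : set R) (EFin \o integrand r) /\
  (\int[lebesgue_measure]_(t in `[(phi o)^-1%R, (phi (r n))^-1%R]) (integrand r t)%:E)%E =
   (\sum_(k < n) rate o par phi (r k.+1) / A (r k.+1))%:E.
Proof.
move=> rr; elim: n => [|n [mI IH]].
  rewrite (proj1 rr) set_itv1; split; first exact: measurable_fun_set1.
  by rewrite integral_set1 big_ord0.
have lt0 k : (phi o)^-1 <= (phi (r k))^-1.
  by rewrite lef_pV2 ?posrE // -(proj1 rr) phi_ray_le.
have lt1 : (phi (r n))^-1 < (phi (r n.+1))^-1 by rewrite ltf_pV2 ?posrE // phi_ray_lt.
have itvE : `[(phi o)^-1, (phi (r n.+1))^-1]%classic =
    `[(phi o)^-1, (phi (r n))^-1]%classic `|`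
    `](phi (r n))^-1, (phi (r n.+1))^-1]%classic :> set R.
  apply/seteqP; split => t; rewrite /= !in_itv /=.
    by move=> /andP[t0 t1]; case: (leP t (phi (r n))^-1) => ?; [left|right]; rewrite ?t0.
  move=> [/andP[-> t1]|/andP[t0 ->]]; last by rewrite andbT (le_trans (lt0 n) (ltW t0)).
  by rewrite (le_trans t1 (ltW lt1)).
have cI t : `](phi (r n))^-1, (phi (r n.+1))^-1]%classic t -> integrand r t = (A (r n.+1))^-1.
  rewrite /= in_itv /= => /andP[t0 t1]; rewrite /integrand (uball_ray (n := n) rr) //.
    by rewrite -[phi _]invrK lef_pV2 // posrE ?invr_gt0 // (lt_trans _ t0) // invr_gt0.
  by rewrite -[ltRHS]invrK ltf_pV2 // posrE ?invr_gt0 // (lt_trans _ t0) // invr_gt0.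
have mc : measurable_fun (`](phi (r n))^-1, (phi (r n.+1))^-1]%classic : set R)
    (EFin \o integrand r).
  apply: (eq_measurable_fun (cst (A (r n.+1))^-1%:E)) => // t; rewrite inE => /cI /= ->.
  by [].
have mU : measurable_fun (`[(phi o)^-1, (phi (r n.+1))^-1]%classic : set R) (EFin \o integrand r).
  by rewrite itvE; apply/measurable_funU.
split=> //; rewrite itvE ge0_integral_setU // -?itvE //; last 2 first.
- by move=> t _; rewrite lee_fin invr_ge0 fine_ge0.
- apply/disj_setPS => t [] /=; rewrite !in_itv /= => /andP[_ h1] /andP[h2 _].
  by move: (lt_le_trans h2 h1); rewrite ltxx.
rewrite IH big_ord_recr /= EFinD; congr (_ + _)%E.
rewrite (eq_integral (cst (A (r n.+1))^-1%:E)); last by move=> t; rewrite inE => /cI ->.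
rewrite integral_cst //= lebesgue_measure_itv /= lte_fin lt1 -EFinD -EFinM mulrC.
rewrite /rate ifN ?(ray_par Ht) //.
by rewrite -(dep_eq0 Ht) (ray_dep Ht rr).
Qed.

Definition jump_term k (z : Ends V * Ends V) : R :=
  (z.1 k == z.2 k)%:R * (rate o par phi (z.1 k) / A (z.1 k)).

Lemma jump_term_ge0 k z : 0 <= jump_term k z.
Proof. by rewrite mulr_ge0 // divr_ge0 ?(rate_ge0 phi_gt0 phi_par) // ltW. Qed.

(** The constant [1 / phi o] is the term [k = 0], because [A o = 1]; the last common vertex has
    index one less than [first_diff]. *)
Lemma jump_kernel_sum r s : bd r -> bd s -> r <> s ->
  Jkernel o ch phi mu r s = (\sum_(k < first_diff r s) jump_term k (r, s))%:E.
Proof.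
move=> rr ss rs; rewrite /Jkernel; case: (pselect _) => [//|rs'] /=.
have eqd k := ray_eq_first_diff k rr ss rs; rewrite /confl.
case: (first_diff r s) (first_diff_gt0 rr ss rs) eqd => // n _ eqd.
rewrite (jump_integral n rr).2 -EFinD big_ord_recl /jump_term /= !eqd mul1r.
rewrite (proj1 rr) /rate eqxx subr0 A_root divr1; congr (_ + _)%:E.
by apply: eq_bigr => k _; rewrite eqd /bump /= !add1n ltnS ltn_ord mul1r.
Qed.

Lemma jump_kernelE r s : bd r -> bd s -> r <> s ->
  (\sum_(0 <= k <oo) (jump_term k (r, s))%:E)%E = Jkernel o ch phi mu r s.
Proof.
move=> rr ss rs; rewrite jump_kernel_sum //.
rewrite (nneseries_split 0 (first_diff r s)); last by move=> k _; rewrite lee_fin jump_term_ge0.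
rewrite eseries0 ?adde0 => [|k]; first by rewrite add0n big_mkord sumEFin.
by rewrite add0n /jump_term (ray_eq_first_diff k rr ss rs) ltnNge => -> _; rewrite mul0r.
Qed.

End JumpKernel.

Arguments jump_term {V} o par ch dep {R} nu phi k z.

(** * The double integral *)

Section GeodesicRays.
Context {V : pointedType} {o : V} {par : V -> V} {ch : V -> seq V} {dep : V -> nat}.
Hypothesis Ht : is_rooted_tree o par ch dep.

(** Moving towards the root cannot go on forever, since depth drops. After one step away from it,
    returning would mean backtracking, because the only way up is the vertex just left. *)
Lemma geodesic_ray_descends (r : nat -> V) : geodesic_ray ch r ->
  exists n0, forall n, (n0 <= n)%N -> r n.+1 \in ch (r n).
Proof.
move=> rr; have step n : r n.+1 \in ch (r n) -> r n.+2 \in ch (r n.+1).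
  move=> d; have [/orP[//|u] _] := rr n.+1; have [_ /eqP] := rr n.
  by rewrite -(par_ch Ht d) -(par_ch Ht u).
have [n0 d0] : exists n0, r n0.+1 \in ch (r n0).
  apply: contrapT => /forallNP up; have up' n : r n \in ch (r n.+1).
    by have [/orP[/up//|]] := rr n.
  have e n : (dep (r n) + n = dep (r 0%N))%N.
    by elim: n => [|n <-]; [rewrite addn0 | rewrite (dep_ch Ht (up' n)) addSnnS].
  by have := leq_addl (dep (r (dep (r 0%N)).+1)) (dep (r 0%N)).+1; rewrite e ltnn.
exists n0 => n /subnK <-; elim: (n - n0)%N => [//|k IH].
by rewrite addSn; exact: step.
Qed.

Lemma geodesic_ray_dep (r : nat -> V) : geodesic_ray ch r ->
  exists n0, forall n, (n - n0 <= dep (r n))%N.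
Proof.
move=> /geodesic_ray_descends[n0 d]; exists n0 => n.
have [n0n|/ltnW nn0] := leqP n0 n; last by rewrite (eqP nn0).
rewrite -{2}(subnK n0n); elim: (n - n0)%N => [//|k IH].
rewrite addSn (dep_ch Ht (d _ _)) ?leq_addl //.
Qed.

Context {R : realType} (phi : V -> R).
Hypothesis vanishes : forall eps : R, 0 < eps ->
  exists S : seq V, forall x, x \notin S -> phi x < eps.

Lemma vanishes_depth eps : 0 < eps -> exists K, forall x, (K <= dep x)%N -> phi x < eps.
Proof.
move=> /vanishes[S HS]; exists (\max_(x <- S) dep x).+1 => x Kx; apply: HS.
by apply: contraTN Kx => xS; rewrite -leqNgt (big_rem x xS) leq_maxl.
Qed.

Lemma geodesic_ray_vanishes (r : nat -> V) : (forall x, 0 <= phi x) -> geodesic_ray ch r ->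
  (phi \o r) @ \oo --> 0.
Proof.
move=> phi0 /geodesic_ray_dep[n0 dr]; apply/cvgr0Pnorm_lt => eps e0.
have [K HK] := vanishes_depth e0; near=> n; rewrite /= ger0_norm //; apply: HK.
apply: leq_trans (dr n); rewrite leq_subRL; last by near: n; exact: nbhs_infty_ge.
by near: n; exact: nbhs_infty_ge.
Unshelve. all: by end_near. Qed.

End GeodesicRays.

(** * Integration over pairs of ends *)

Section DoubleIntegral.
Context {V : pointedType} {o : V} {par : V -> V} {ch : V -> seq V} {dep : V -> nat}.
Hypothesis Ht : is_rooted_tree o par ch dep.
Context {R : realType} (nu : V -> probability (Ends V) R) (phi : V -> R).
Hypothesis phi_gt0 : forall x, 0 < phi x.
Hypothesis phi_par : forall x, x != o -> phi x < phi (par x).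
Local Notation bd := (bdry o ch).
Local Notation B := (bdry_sub o ch dep).
Local Notation mu := (nu o).
Local Notation A := (harm o ch dep nu o).
Local Notation level := (level o ch).
Local Notation rate := (rate o par phi).
Hypothesis A_gt0 : forall x, 0 < A x.
Hypothesis A_root : A o = 1.

Let mbd : measurable bd. Proof. exact: (measurable_bdry Ht). Qed.
Let mB x : measurable (B x). Proof. exact: (measurable_bdry_sub Ht). Qed.

Definition cell_ind x (z : Ends V * Ends V) : R := \1_(B x) z.1 * \1_(B x) z.2.

(** Agrees with [jump_term] on pairs of ends, but as a finite combination of product indicators: it
    is measurable on the product and integrates cell by cell. *)
Definition jump_weight k z : R := \sum_(x <- level k) rate x / A x * cell_ind x z.

Lemma cell_ind_ge0 x z : 0 <= cell_ind x z.
Proof. by rewrite mulr_ge0. Qed.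

Lemma cell_weight_ge0 x : 0 <= rate x / A x.
Proof. by rewrite divr_ge0 ?(rate_ge0 phi_gt0 phi_par) // ltW. Qed.

Lemma jump_weight_ge0 k z : 0 <= jump_weight k z.
Proof. by apply: sumr_ge0 => x _; rewrite mulr_ge0 ?cell_ind_ge0 ?cell_weight_ge0. Qed.

Lemma jump_weightE k z : bd z.1 -> bd z.2 -> jump_weight k z = jump_term o par ch dep nu phi k z.
Proof.
move=> z1 z2; rewrite /jump_weight /jump_term.
rewrite (bigD1_seq (z.1 k)) ?(ray_level Ht) ?(level_uniq Ht) //= big1_seq ?addr0.
  rewrite mulrC /cell_ind !indicE; congr (_ * _).
  rewrite [z.1 \in _]mem_set ?mul1r; last by split=> //; rewrite (ray_dep Ht).
  congr (nat_of_bool _)%:R; apply/idP/eqP; rewrite inE.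
    by move=> [_]; rewrite (ray_dep Ht).
  by move=> e; split=> //; rewrite (ray_dep Ht).
move=> x /andP[xz]; rewrite (mem_level Ht) => /eqP dx.
rewrite /cell_ind indicE [z.1 \in _]memNset ?mul0r ?mulr0 // => -[_].
by rewrite dx => e; rewrite e eqxx in xz.
Qed.

Lemma jump_weight_out k z : ~ (bd z.1 /\ bd z.2) -> jump_weight k z = 0.
Proof.
move=> nz; rewrite /jump_weight big1 // => x _; rewrite /cell_ind !indicE.
case: (boolP (z.1 \in B x)) => [|_]; last by rewrite mul0r mulr0.
case: (boolP (z.2 \in B x)) => [|_]; last by rewrite !mulr0.
by rewrite !inE => -[z2 _] [z1 _]; case: nz.
Qed.

(* The jump kernel extended by 0 to the diagonal and to pairs that are not ends. *)
Definition jump_density (z : Ends V * Ends V) : R :=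
  if pselect (bd z.1 /\ bd z.2) then fine (Jkernel o ch phi mu z.1 z.2) else 0.

Lemma jump_densityE r s : bd r -> bd s -> Jkernel o ch phi mu r s = (jump_density (r, s))%:E.
Proof.
move=> rr ss; rewrite /jump_density /=; case: pselect => [_|[]] //=.
have [->|rs] := pselect (r = s); first by rewrite /Jkernel; case: (pselect _).
by rewrite (jump_kernel_sum Ht phi_gt0 phi_par A_root).
Qed.

(** On the diagonal the density is 0 while the weights need not be; the squared difference makes
    every term vanish there. *)
Lemma jump_density_series (u : Ends V -> R) z :
  (\sum_(0 <= k <oo) ((u z.1 - u z.2) ^+ 2 * jump_weight k z)%:E)%E =
  ((u z.1 - u z.2) ^+ 2 * jump_density z)%:E.
Proof.
have [[z1 z2]|nz] := pselect (bd z.1 /\ bd z.2); last first.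
  rewrite /jump_density; case: pselect => //= _; rewrite mulr0 eseries0 // => k _ _.
  by rewrite jump_weight_out // mulr0.
have [e|ne] := pselect (z.1 = z.2).
  by rewrite e subrr expr0n mul0r eseries0 // => k _ _; rewrite mul0r.
under eq_eseriesr => k _ do rewrite EFinM.
rewrite nneseriesZl; last by move=> k _; rewrite lee_fin jump_weight_ge0.
rewrite [RHS]EFinM; congr (_ * _)%E; under eq_eseriesr => k _ do rewrite jump_weightE //.
have -> : z = (z.1, z.2) by case: z {z1 z2 ne}.
by rewrite -jump_densityE //= -(jump_kernelE Ht phi_gt0 phi_par A_gt0 A_root).
Qed.

Section Function.
Variable u : Ends V -> R.
Hypothesis ui : mu.-integrable bd (EFin \o u).
Hypothesis u2 : (\int[mu]_(r in bd) (u r ^+ 2)%:E < +oo)%E.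
Local Notation X := (average o ch dep nu u).
Local Notation Q x := (fine (\int[mu]_(r in B x) (u r ^+ 2)%:E)).

Let mu' : measurable_fun bd u. Proof. by apply/measurable_EFinP; case/integrableP: ui. Qed.

Let dist_cell x (z : Ends V * Ends V) : R := (u z.1 - u z.2) ^+ 2 * cell_ind x z.

Let measurable_dist_cell x : measurable_fun setT (dist_cell x).
Proof.
have mut : measurable_fun setT (u \_ bd) by exact/(measurable_restrictT u mbd).
have -> : dist_cell x = fun z => ((u \_ bd) z.1 - (u \_ bd) z.2) ^+ 2 * cell_ind x z.
  apply/funext => z; rewrite /dist_cell /cell_ind !indicE.
  case: (boolP (z.1 \in B x)) => [|_]; last by rewrite !mul0r !mulr0.
  case: (boolP (z.2 \in B x)) => [|_]; last by rewrite !mulr0.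
  by rewrite !inE => -[z2 _] [z1 _]; rewrite !patchT ?inE.
apply: measurable_funM.
  apply: measurable_funX; apply: measurable_funB.
    exact: measurableT_comp.
  exact: measurableT_comp.
by apply: measurable_funM; apply: measurableT_comp => //; exact: measurable_indic.
Qed.

Let integral_ind x (h : Ends V -> R) :
  (\int[mu]_r (h r * \1_(B x) r)%:E = \int[mu]_(r in B x) (h r)%:E)%E.
Proof.
rewrite [RHS]integral_mkcond; apply: eq_integral => r _.
rewrite patchE indicE; case: ifP => _; first by rewrite mulr1.
by rewrite mulr0.
Qed.

(** The integral of [(u r - u s)^2] over the square of a cell is twice its mass times the
    unnormalized variance; the mass later cancels the [1 / A x] in [jump_weight]. *)
Lemma integral_dist_cell x : (\int[mu \x mu]_z ((u z.1 - u z.2) ^+ 2 * cell_ind x z)%:E =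
  ((A x * (Q x - A x * X x ^+ 2)) *+ 2)%:E)%E.
Proof.
rewrite fubini_tonelli1; last 2 first.
- by apply/measurable_EFinP; exact: measurable_dist_cell.
- by move=> z; rewrite lee_fin mulr_ge0 ?sqr_ge0 ?cell_ind_ge0.
transitivity (\int[mu]_r ((A x * u r ^+ 2 + - (X x * A x *+ 2) * u r + Q x) * \1_(B x) r)%:E)%E.
  apply: eq_integral => r _; rewrite /fubini_F /=.
  have [rx|rx] := boolP (r \in B x).
    under eq_integral => s _ do rewrite /cell_ind /= [\1_(B x) r]indicE rx mul1r.
    rewrite integral_ind (integral_square_dist Ht A_gt0 ui u2) indicE rx mulr1.
    by congr (_%:E); rewrite !mulr2n; ring.
  rewrite indicE (negbTE rx) mulr0; apply: integral0_eq => s _.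
  by rewrite /cell_ind /= indicE (negbTE rx) mul0r mulr0.
rewrite integral_ind (integral_quadratic Ht A_gt0 ui u2).
by congr (_%:E); rewrite !mulr2n; ring.
Qed.

Let measurable_dist_weight k :
  measurable_fun setT (fun z => ((u z.1 - u z.2) ^+ 2 * jump_weight k z)%:E).
Proof.
apply/measurable_EFinP; rewrite /jump_weight.
have -> : (fun z => (u z.1 - u z.2) ^+ 2 * \sum_(x <- level k) rate x / A x * cell_ind x z) =
          (fun z => \sum_(x <- level k) rate x / A x * dist_cell x z).
  by apply/funext => z; rewrite mulr_sumr; apply: eq_bigr => x _; rewrite mulrCA.
by apply: measurable_sum => x; apply: measurable_funM => //; exact: measurable_dist_cell.
Qed.

Lemma integral_dist_weight k :
  (\int[mu \x mu]_z ((u z.1 - u z.2) ^+ 2 * jump_weight k z)%:E =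
   ((\sum_(x <- level k) rate x * (Q x - A x * X x ^+ 2)) *+ 2)%:E)%E.
Proof.
transitivity (\int[mu \x mu]_z (\sum_(x <- level k) (rate x / A x)%:E * (dist_cell x z)%:E))%E.
  apply: eq_integral => z _; rewrite /jump_weight mulr_sumr -sumEFin.
  by apply: eq_bigr => x _; rewrite -EFinM mulrCA.
have md x : measurable_fun setT (EFin \o dist_cell x) by exact/measurable_EFinP.
have d0 x z : (0 <= (dist_cell x z)%:E)%E by rewrite lee_fin mulr_ge0 ?sqr_ge0 ?cell_ind_ge0.
rewrite ge0_integral_sum //; last 2 first.
- by move=> x; exact: (measurable_funeM _ (md x)).
- by move=> x z _; rewrite mule_ge0 // lee_fin cell_weight_ge0.
rewrite -sumrMnl -sumEFin; apply: eq_bigr => x _.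
rewrite ge0_integralZl_EFin ?cell_weight_ge0 //; last exact: md.
rewrite [X in (_ * X)%E](integral_dist_cell x) -EFinM.
congr (_%:E).
by rewrite -!mulrnAr mulrA divfK // gt_eqF.
Qed.

Let dist_jump (z : Ends V * Ends V) : R := (u z.1 - u z.2) ^+ 2 * jump_density z.

(** Measurability is obtained for the product with the squared difference, as a series of measurable
    nonnegative functions. *)
Lemma measurable_dist_jump : measurable_fun setT (EFin \o dist_jump).
Proof.
rewrite (_ : _ \o _ = fun z => (\sum_(0 <= k <oo) ((u z.1 - u z.2) ^+ 2 * jump_weight k z)%:E)%E).
  apply: ge0_emeasurable_sum => // k z _ _.
  by rewrite lee_fin mulr_ge0 ?sqr_ge0 ?jump_weight_ge0.
by apply/funext => z; rewrite jump_density_series.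
Qed.

Lemma integral_dist_jump (L : R) :
  \sum_(k < N) \sum_(x <- level k) rate x * (Q x - A x * X x ^+ 2) @[N --> \oo] --> L ->
  (\int[mu \x mu]_z (dist_jump z)%:E = (L *+ 2)%:E)%E.
Proof.
move=> cL; under eq_integral => z _ do rewrite /dist_jump -jump_density_series.
rewrite integral_nneseries //; last first.
  by move=> k z _; rewrite lee_fin mulr_ge0 ?sqr_ge0 ?jump_weight_ge0.
under eq_eseriesr => k _ do rewrite integral_dist_weight.
apply: cvg_lim => //; apply: cvg_EFin; first by near=> n; rewrite sumEFin.
rewrite (_ : fine \o _ = fun N =>
  (\sum_(k < N) \sum_(x <- level k) rate x * (Q x - A x * X x ^+ 2)) *+ 2).
  under eq_fun => N do rewrite mulr2n.
  by rewrite mulr2n; apply: cvgD.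
by apply/funext => N; rewrite /= sumEFin /= big_mkord sumrMnl.
Unshelve. all: by end_near. Qed.

End Function.
End DoubleIntegral.

Arguments jump_density {V} o ch {R} nu phi z.

(** * The Dirichlet form *)

Section DirichletForm.
Context {V : pointedType} {o : V} {par : V -> V} {ch : V -> seq V} {dep : V -> nat}.
Context {R : realType} {p : V -> V -> R} {nu : V -> probability (Ends V) R}.
Hypothesis Ht : is_rooted_tree o par ch dep.
Hypothesis Hw : is_nn_random_walk o par ch p.
Hypothesis Htr : transient o par ch p.
Hypothesis HF : forall x, x != o -> hitF o par ch p x (par x) < 1.
Hypothesis Hgreen : forall eps : R, 0 < eps ->
  exists S : seq V, forall x, x \notin S -> green o par ch p x o < eps.
Hypothesis Hnu : is_limit_distribution o par ch dep p nu.
Local Notation bd := (bdry o ch).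
Local Notation mu := (nu o).
Local Notation A := (harm o ch dep nu o).
Local Notation phi := (fun x => green o par ch p x o).
Local Notation energy := (ET_partial o par ch dep p).
Local Notation P := (poisson o ch nu).
Local Notation density := (jump_density o ch nu phi).

Let mbd : measurable bd. Proof. exact: (measurable_bdry Ht). Qed.
Let phi_gt0 x : 0 < phi x. Proof. exact: (green_root_gt0 Ht Hw Htr). Qed.
Let phi_par x : x != o -> phi x < phi (par x).
Proof. exact: (green_par_lt Ht Hw Htr HF). Qed.
Let A_gt0 x : 0 < A x. Proof. exact: (harm_root_gt0 Ht Hw Htr HF Hnu). Qed.
Let A_root : A o = 1. Proof. exact: (harm_root Ht Hnu). Qed.

Lemma green_ultrametric_element : is_ultrametric_element o par ch phi.
Proof.
split=> // r; apply: (geodesic_ray_vanishes Ht Hgreen) => x; exact: ltW.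
Qed.

Lemma energy_ge0 h N : 0 <= energy h h N.
Proof.
rewrite /ET_partial big_nat_cond; apply: sumr_ge0 => n; rewrite andbT => /andP[n1 _].
rewrite big_seq; apply: sumr_ge0 => x; rewrite (mem_level Ht) => /eqP dx.
rewrite mulr_ge0 -?expr2 ?sqr_ge0 // ltW // (cond_gt0 Ht Hw) //.
by rewrite -(dep_eq0 Ht) dx -lt0n.
Qed.

Lemma energy_nondecreasing h : nondecreasing_seq (energy h h).
Proof.
apply/nondecreasing_seqP => -[|n]; first by rewrite {1}/ET_partial big_geq // energy_ge0.
rewrite [leRHS]/ET_partial big_nat_recr // lerDl.
rewrite big_seq; apply: sumr_ge0 => x; rewrite (mem_level Ht) => /eqP dx.
rewrite mulr_ge0 -?expr2 ?sqr_ge0 // ltW // (cond_gt0 Ht Hw) //.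
by rewrite -(dep_eq0 Ht) dx.
Qed.

Lemma energy_polarization h k N :
  energy h k N = (energy (h \+ k) (h \+ k) N - energy (h \- k) (h \- k) N) / 4.
Proof.
rewrite /ET_partial -sumrB mulr_suml; apply: eq_bigr => n _.
by rewrite -sumrB mulr_suml; apply: eq_bigr => x _ /=; field.
Qed.

Lemma energy_parallelogram h k N :
  energy (h \+ k) (h \+ k) N + energy (h \- k) (h \- k) N =
  (energy h h N + energy k k N) *+ 2.
Proof.
rewrite /ET_partial -!big_split /= -sumrMnl; apply: eq_bigr => n _.
by rewrite -!big_split /= -sumrMnl; apply: eq_bigr => x _ /=; rewrite mulr2n; ring.
Qed.

Lemma energy_bounded h : cvgn (energy h h) -> forall N, energy h h N <= limn (energy h h).
Proof. exact/nondecreasing_cvgn_le/energy_nondecreasing. Qed.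

Lemma poisson_add f g : mu.-integrable bd (EFin \o f) -> mu.-integrable bd (EFin \o g) ->
  P (f \+ g) = P f \+ P g.
Proof. by move=> fi gi; apply/funext => x; exact: (poissonD Ht Hw Htr HF Hnu). Qed.

Lemma poisson_sub f g : mu.-integrable bd (EFin \o f) -> mu.-integrable bd (EFin \o g) ->
  P (f \- g) = P f \- P g.
Proof. by move=> fi gi; apply/funext => x; exact: (poissonB Ht Hw Htr HF Hnu). Qed.

Lemma in_D_add_sub f g : in_D o par ch dep p nu f -> in_D o par ch dep p nu g ->
  in_D o par ch dep p nu (f \+ g) /\ in_D o par ch dep p nu (f \- g).
Proof.
move=> [fi cf] [gi cg].
have bound N := lerD (energy_bounded cf N) (energy_bounded cg N).
split; split.
- exact: (integrableD mbd fi gi).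
- rewrite poisson_add //; apply: nondecreasing_is_cvgn; first exact: energy_nondecreasing.
  exists ((limn (energy (P f) (P f)) + limn (energy (P g) (P g))) *+ 2) => _ [N _ <-].
  apply: (@le_trans _ _ ((energy (P f) (P f) N + energy (P g) (P g) N) *+ 2)).
    by rewrite -energy_parallelogram lerDl energy_ge0.
  by rewrite lerMn2r bound orbT.
- exact: (integrableB mbd fi gi).
- rewrite poisson_sub //; apply: nondecreasing_is_cvgn; first exact: energy_nondecreasing.
  exists ((limn (energy (P f) (P f)) + limn (energy (P g) (P g))) *+ 2) => _ [N _ <-].
  apply: (@le_trans _ _ ((energy (P f) (P f) N + energy (P g) (P g) N) *+ 2)).
    by rewrite -energy_parallelogram lerDr energy_ge0.
  by rewrite lerMn2r bound orbT.
Qed.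

(** [in_D] provides convergence of quadratic energies; convergence of the mixed one follows from
    those of the sum and the difference. *)
Lemma E_HD_polarization f g : in_D o par ch dep p nu f -> in_D o par ch dep p nu g ->
  E_HD o par ch dep p nu f g =
  (E_HD o par ch dep p nu (f \+ g) (f \+ g) - E_HD o par ch dep p nu (f \- g) (f \- g)) / 4.
Proof.
move=> fD gD; have [[_ ca] [_ cs]] := in_D_add_sub fD gD.
have [[fi _] [gi _]] := (fD, gD); rewrite /E_HD /ET.
rewrite poisson_add // in ca *; rewrite poisson_sub // in cs *.
apply: cvg_lim => //.
rewrite (_ : energy _ _ = fun N => (energy (P f \+ P g) (P f \+ P g) N -
    energy (P f \- P g) (P f \- P g) N) / 4); last first.
  by apply/funext => N; exact: energy_polarization.
by apply: cvgM; [exact: cvgB|exact: cvg_cst].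
Qed.

Section Quadratic.
Variable f : Ends V -> R.
Hypothesis fD : in_D o par ch dep p nu f.
Local Notation X := (average o ch dep nu f).
Local Notation L := (E_HD o par ch dep p nu f f).

Let fi : mu.-integrable bd (EFin \o f). Proof. by case: fD. Qed.
Let A_ge0 x : 0 <= A x. Proof. exact: ltW. Qed.
Let A_ch x : \sum_(y <- ch x) A y = A x. Proof. exact: (harm_ch Ht). Qed.
Let AX_ch x : \sum_(y <- ch x) A y * X y = A x * X x.
Proof. exact: (harm_average_ch Ht Hw Htr HF Hnu). Qed.

Lemma jump_energy_cvg_E_HD : jump_energy o ch A phi X @ \oo --> L.
Proof.
have h_par x : x != o -> P f x = phi x / phi (par x) * P f (par x) +
    (1 - phi x / phi (par x)) * X x.
  by move=> xo; exact: (poisson_par Ht Hw Htr HF Hnu).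
apply: (jump_energy_cvg Ht A_ge0 A_ch phi_gt0 phi_par AX_ch _ h_par).
- exact: (poisson_root Ht Hnu).
- by move=> eps e0; exact: (vanishes_depth Hgreen).
(* [ET_partial] starts at level 1 and excludes its upper bound, so [N] generations of edges
   correspond to the index [N.+1]. *)
rewrite (_ : (fun N => _) = fun N => energy (P f) (P f) N.+1); last first.
  apply/funext => N; rewrite /ET_partial big_add1 /= big_mkord; apply: eq_bigr => k _.
  rewrite -(harmonic_energyE (c := cond par dep p) Ht phi_gt0 h_par) // => x xo.
  exact: (cond_green Ht Hw Htr Hnu).
by rewrite cvg_shiftS; case: fD => _ c; exact: c.
Qed.

Lemma in_D_square_integrable : (\int[mu]_(r in bd) (f r ^+ 2)%:E < +oo)%E.
Proof.
have cV := jump_energy_cvg_E_HD.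
have VL N : jump_energy o ch A phi X N <= L.
  rewrite -(cvg_lim _ cV) //; apply: nondecreasing_cvgn_le; last by apply/cvg_ex; exists L.
  apply/nondecreasing_seqP => n; rewrite /jump_energy big_ord_recr /= lerDl.
  apply: sumr_ge0 => x _; rewrite divr_ge0 ?(ltW (phi_gt0 _)) //.
  by apply: sumr_ge0 => y _; rewrite mulr_ge0 ?sqr_ge0.
have b := level_square_root_bound Ht A_ge0 A_ch phi_gt0 phi_par AX_ch VL.
have := square_integral_le Ht A_gt0 fi (fun N _ => b N).
by rewrite (bdry_sub_root Ht) => h; apply: le_lt_trans h _; rewrite ltry.
Qed.

Lemma integral_jump_E_HD :
  (\int[mu \x mu]_z ((f z.1 - f z.2) ^+ 2 * density z)%:E = (L *+ 2)%:E)%E.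
Proof.
apply: (integral_dist_jump Ht phi_gt0 phi_par A_gt0 A_root fi in_D_square_integrable).
apply: (level_var_series Ht A_ge0 A_ch phi_gt0 phi_par AX_ch jump_energy_cvg_E_HD).
by move=> x; apply: (level_square_cvg Ht A_gt0 fi in_D_square_integrable).
Qed.

Lemma integrable_jump : (mu \x mu)%E.-integrable setT
  (fun z => ((f z.1 - f z.2) ^+ 2 * density z)%:E).
Proof.
apply/integrableP; split.
  exact: (measurable_dist_jump Ht phi_gt0 phi_par A_gt0 A_root fi).
rewrite (eq_integral (fun z => ((f z.1 - f z.2) ^+ 2 * density z)%:E)).
  by rewrite integral_jump_E_HD ltry.
move=> z _; rewrite gee0_abs // lee_fin mulr_ge0 ?sqr_ge0 //.
rewrite /jump_density; case: pselect => //= -[z1 z2]; rewrite fine_ge0 //.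
have [e|ne] := pselect (z.1 = z.2); first by rewrite e /Jkernel; case: (pselect _).
rewrite (jump_kernel_sum Ht phi_gt0 phi_par A_root) // lee_fin; apply: sumr_ge0 => k _.
exact: (jump_term_ge0 phi_gt0 phi_par A_gt0).
Qed.

End Quadratic.

Lemma E_HD_double_integral f g : in_D o par ch dep p nu f -> in_D o par ch dep p nu g ->
  (E_HD o par ch dep p nu f g)%:E = ((2^-1)%:E * \int[mu]_(xi in bd) \int[mu]_(eta in bd)
    (((f xi - f eta) * (g xi - g eta))%:E * Jkernel o ch phi mu xi eta))%E.
Proof.
move=> fD gD; have [aD sD] := in_D_add_sub fD gD.
pose Phi z := ((f z.1 - f z.2) * (g z.1 - g z.2) * density z)%:E.
pose a z := (((f \+ g) z.1 - (f \+ g) z.2) ^+ 2 * density z)%:E.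
pose s z := (((f \- g) z.1 - (f \- g) z.2) ^+ 2 * density z)%:E.
have PhiE z : Phi z = ((4^-1)%:E * (a z - s z))%E.
  by rewrite /Phi /a /s -EFinB -EFinM; congr (_%:E) => /=; field.
have ia := integrable_jump aD; have is_ := integrable_jump sD.
have ias : (mu \x mu)%E.-integrable setT (fun z => (a z - s z)%E).
  exact: (integrableB measurableT ia is_).
have iPhi : (mu \x mu)%E.-integrable setT Phi.
  rewrite (_ : Phi = fun z => ((4^-1)%:E * (a z - s z))%E); last exact/funext.
  exact: integrableZl.
(* The quadratic identity counts each pair of ends in both orders; the prefactor [1/2] of the claim
   removes this factor 2. *)
have intPhi : (\int[mu \x mu]_z Phi z = (E_HD o par ch dep p nu f g *+ 2)%:E)%E.
  under eq_integral => z _ do rewrite PhiE.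
  rewrite integralZl // (integralB measurableT ia is_).
  rewrite (integral_jump_E_HD aD) (integral_jump_E_HD sD) (E_HD_polarization fD gD).
  by rewrite -EFinB -EFinM; congr (_%:E); rewrite !mulr2n; field.
have outPhi z : ~ (bd z.1 /\ bd z.2) -> Phi z = 0%E.
  by move=> nz; rewrite /Phi /jump_density; case: pselect => //= _; rewrite mulr0.
have -> : (\int[mu]_(xi in bd) \int[mu]_(eta in bd)
    (((f xi - f eta) * (g xi - g eta))%:E * Jkernel o ch phi mu xi eta) =
    \int[mu \x mu]_z Phi z)%E.
  (* Fubini for a signed integrand, justified by [iPhi]; the two restrictions to [bd] are absorbed
     by the vanishing of [Phi] off pairs of ends. *)
  rewrite -integral12_prod_meas1 // integral_mkcond.
  apply: eq_integral => xi _.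
  rewrite /fubini_F patchE; case: ifPn => [|/negP] xib; rewrite inE in xib.
    rewrite [LHS]integral_mkcond; apply: eq_integral => eta _.
    rewrite patchE; case: ifPn => [|/negP] etab; rewrite inE in etab.
      by rewrite (jump_densityE Ht phi_gt0 phi_par A_root) // -EFinM.
    by rewrite outPhi // => -[].
  by rewrite integral0_eq // => eta _; rewrite outPhi // => -[].
by rewrite intPhi -EFinM; congr (_%:E); rewrite mulr2n; field.
Qed.

End DirichletForm.

Theorem theorem4p1 (R : realType) (V : pointedType) (o : V) (par : V -> V)
    (ch : V -> seq V) (dep : V -> nat) (p : V -> V -> R)
    (nu : V -> probability (Ends V) R) :
  is_rooted_tree o par ch dep ->
  ~ finite_set [set: V] ->
  (forall x, (2 <= size (ch x))%N) ->
  is_nn_random_walk o par ch p ->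
  transient o par ch p ->
  (forall x, x != o -> hitF o par ch p x (par x) < 1) ->
  (forall eps : R, 0 < eps ->
     exists A : seq V, forall x, x \notin A -> green o par ch p x o < eps) ->
  is_limit_distribution o par ch dep p nu ->
  let phi : V -> R := fun x => green o par ch p x o in
  is_ultrametric_element o par ch phi /\
  forall f g : Ends V -> R,
    in_D o par ch dep p nu f -> in_D o par ch dep p nu g ->
    (E_HD o par ch dep p nu f g)%:E =
    ((2^-1)%:E *
     \int[nu o]_(xi in bdry o ch) \int[nu o]_(eta in bdry o ch)
        (((f xi - f eta) * (g xi - g eta))%:E * Jkernel o ch phi (nu o) xi eta))%E.
Proof.
move=> Ht _ _ Hw Htr HF Hgreen Hnu phi; split.
  exact: (green_ultrametric_element Ht Hw Htr HF Hgreen).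
by move=> f g; exact: (E_HD_double_integral Ht Hw Htr HF Hgreen Hnu).
Qed.
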